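(* Let $(X,C=\sum c_iC_i)$ be a surface pair with $C\neq0$, whose minimal orbifold log resolution $(\tilde X,\tilde C\cup E)$ is not star-shaped. Suppose that all non-zero $c_i$ are $\geq 1/2$. Then: (1) $N=\sum(1-c_i)D_i$, the sum being over all maximal end strings $S_i$ of $E$, is the negative part of the Zariski decomposition of $K_{\tilde X}+E+\sum c_i\tilde C_i$. (2) If $(X,C)$ is log canonical, then the dual graph of $E$ is as follows: a chain of smooth rational curves $F_1,\dots,F_k$, $k\ge2$ (consecutive ones meeting once transversally), together with two further curves attached to $F_1$ and two further curves attached to $F_k$, each of these four further curves meeting $E$ only in that one attachment; each of the four further curves is either a smooth rational $-1$ curve met by exactly one $\tilde C_i$, having coefficient $c_i=1/2$, or a smooth rational $-2$ curve met by no $\tilde C_i$ (and no $\tilde C_i$ meets any other curve of $E$).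
   Context: A surface pair $(X,C)$ consists of a germ $(X,0)$ of a complex normal surface and a finite sum $C=\sum c_iC_i$ of distinct irreducible Weil divisors (curve germs through $0$) with $c_i\in[0,1]\cap\mathbb Q$. Components with $c_i=0$ are omitted when forming resolutions. A log resolution of $(X,C)$ is a good resolution $\pi:(\tilde X,E)\to(X,0)$ ($E=\bigcup E_j$ the reduced exceptional divisor, smooth components, normal crossings) such that $E\cup\pi^{-1}(\bigcup C_i)$ has simple normal crossings; $\tilde C_i$ is the strict transform of $C_i$. An end curve of $E$ is a component meeting exactly one other component. The minimal orbifold log resolution is the minimal log resolution with the property that every $\tilde C_i$ meets an end curve of $E$ and each end curve meets at most one $\tilde C_i$. The graph is star-shaped if it consists of one central curve with strings of rational curves emanating from it (chains of rational curves are counted as star-shaped). A maximal end string of $E$ is a sequence of smooth rational curves $E_1,\dots,E_s$ with $E_j\cdot E_{j+1}=1$ for $1\le j<s$, such that $E_2,\dots,E_s$ have no other intersections in $E$ (so the last one is an end curve), and $E_1$ meets exactly one other curve of $E$, which has positive genus or valence at least $3$. To each maximal end string $S_i$ is attached the effective $\mathbb Q$-cycle $D_i=\sum_j b_jE_j$ supported on $S_i$ with $D_i\cdot E_s=-1$ and $D_i\cdot E_j=0$ for $j<s$; and $c_i$ denotes the coefficient in $C$ of the curve whose strict transform meets the end curve $E_s$ of $S_i$, with $c_i=0$ if there is none. Numerical convention: each $\mathbb Q$-divisor on $\tilde X$ is identified with the unique exceptional $\mathbb Q$-divisor having the same intersection number with every $E_j$. Every exceptional $\mathbb Q$-divisor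 $L$ has a unique Zariski decomposition $L=P+N$ with $P\cdot E_j\ge0$ for all $j$, $N$ effective, and $P\cdot E_j=0$ for $E_j\subset\mathrm{Supp}\,N$; $N$ is the negative part. Writing $K_{\tilde X}+\sum c_i\tilde C_i\equiv\sum a_jE_j$, $(X,C)$ is log canonical if all $a_j\ge-1$. *)

(* Defs.v *)
(* A good resolution of a normal surface germ together with the strict
   transforms of the curve germs C_i is recorded by its decorated dual graph:
   the exceptional curves E_v, their genera, their intersection numbers, and,
   for each C_i, the exceptional curve met by its strict transform.  All notions
   below (numerical divisor classes, point blow-ups, dominance of resolutions,
   Zariski decomposition, log canonicity) depend on these data only. *)
From HB Require Import structures.
From mathcomp Require Import all_boot all_order all_algebra.

Set Implicit Arguments.
Unset Strict Implicit.
Unset Printing Implicit Defensive.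

Import Order.TTheory GRing.Theory Num.Theory.
Local Open Scope ring_scope.

(* The index type I labels the branches C_i.  The strict transform of an
   irreducible germ is an irreducible germ; when the total transform has simple
   normal crossings it meets exactly one E_v, transversally, at a point lying on
   no other curve.  So it is determined by that E_v, called [foot i], and
   C~_i . E_v is 1 if v = foot i and 0 otherwise. *)
Record dual_graph (I : finType) := DualGraph {
  curve :> finType;
  genus : curve -> nat;
  dot : curve -> curve -> int;
  foot : I -> curve
}.
Arguments DualGraph {I}.

(* Components with zero coefficient are omitted when forming resolutions. *)
Definition branch (I : finType) (c : I -> rat) : finType := {i : I | c i != 0}.

Section Graph.
Variables (I : finType) (G : dual_graph I).
Implicit Types (x y e v : G) (s : seq G) (Z : {ffun G -> rat}).

(* Number of points in which E_v meets the other components.  Two components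
   may meet in several points (normal crossings), hence the multiplicities. *)
Definition valence v : int := \sum_(w : G | w != v) dot v w.

(* A leaf of the dual graph.  A curve meeting a single other component, but in
   two points, is not an end curve: it is not an end of any string. *)
Definition end_curve v : bool := valence v == 1.

(* The intersection number Z . E_v. *)
Definition edot Z v : rat := \sum_(w : G) Z w * (dot w v)%:~R.

Definition adjacent : rel G := fun x y => (x != y) && (dot x y != 0).

(* Negative definiteness is the Du Val - Mumford criterion; connectedness holds
   because the germ is normal.  By Grauert's theorem every such graph occurs. *)
Definition is_log_resolution : Prop :=
  [/\ forall x y, dot x y = dot y x,
      forall x y, x != y -> 0 <= dot x y,
      forall Z, Z != 0 -> \sum_(v : G) Z v * edot Z v < 0
    & forall x y, connect adjacent x y].

Definition is_orbifold : Prop :=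
  (forall i, end_curve (foot G i)) /\
  (forall e, end_curve e -> forall i j, foot G i = e -> foot G j = e -> i = j).

Definition path_edges s : seq (G * G) := zip s (behead s).

Definition linked (es : seq (G * G)) x y : bool :=
  ((x, y) \in es) || ((y, x) \in es).

Definition edges_are (es : seq (G * G)) : Prop :=
  forall x y, x != y -> dot x y = (linked es x y : nat)%:Z.

(* A central curve v of any genus, and a list of strings of rational curves,
   each attached to v by its first curve. *)
Definition star_shaped : Prop :=
  exists (v : G) (ss : seq (seq G)),
    [/\ perm_eq (v :: flatten ss) (enum G),
        forall x, x \in flatten ss -> genus x = 0%N
      & edges_are (flatten [seq path_edges (v :: s) | s <- ss])].

(* s = E_1, ..., E_s, and f is the curve of positive genus or valence at least 3
   to which E_1 is attached: each curve of s meets only its neighbours in the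
   chain f, E_1, ..., E_s, in one point each. *)
Definition max_end_string s : bool :=
  (s != [::]) && all (fun x => genus x == 0%N) s &&
  [exists f : G,
    [&& uniq (f :: s), (0 < genus f)%N || (3 <= valence f) &
        all (fun x => [forall y : G, (y != x) ==>
               (dot x y == (linked (path_edges (f :: s)) x y : nat)%:Z)]) s]].

Definition last_of s e : bool := (e \in s) && (last e s == e).

(* These conditions determine the Q-cycle of the string; its effectivity is a
   consequence. *)
Definition string_cycle s Z : Prop :=
  (forall v, v \notin s -> Z v = 0) /\
  (forall v, v \in s -> edot Z v = if last_of s v then -1 else 0).

(* A Q-divisor on the resolution enters through its intersection numbers with
   the E_v; [Z] is the exceptional Q-divisor identified with it. *)
Definition equiv_to Z (l : G -> rat) : Prop := forall v, edot Z v = l v.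

(* K . E_v, by adjunction. *)
Definition dotK v : rat := 2 * (genus v)%:R - 2 - (dot v v)%:~R.

Definition dotE v : rat := \sum_(w : G) (dot w v)%:~R.

Definition dotC i v : rat := (foot G i == v)%:R.

Definition zariski_decomposition (L P N : {ffun G -> rat}) : Prop :=
  [/\ L = P + N, forall v, 0 <= edot P v, forall v, 0 <= N v
    & forall v, N v != 0 -> edot P v = 0].

Definition is_negative_part (l : G -> rat) (N : {ffun G -> rat}) : Prop :=
  exists L P, equiv_to L l /\ zariski_decomposition L P N.

End Graph.

Arguments dotE {I} G v.
Arguments dotK {I} G v.
Arguments dotC {I} G i v.

Section Pair.
Variables (I : finType) (c : I -> rat) (G : dual_graph (branch c)).

Definition end_coef (s : seq G) : rat :=
  if [pick i | last_of s (foot G i)] is Some i then c (val i) else 0.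

(* Intersection numbers of the Q-divisor sum_i c_i C~_i. *)
Definition dotcC (v : G) : rat := \sum_(i : branch c) c (val i) * dotC G i v.

Definition log_canonical : Prop :=
  exists A : {ffun G -> rat},
    equiv_to A (fun v => dotK G v + dotcC v) /\ forall v, -1 <= A v.

(* The sum of (1 - c_i) D_i over all maximal end strings; these have no
   repetitions, hence length at most the number of curves. *)
Definition end_string_sum (D : seq G -> {ffun G -> rat}) : {ffun G -> rat} :=
  [ffun v => \sum_(n < #|G|.+1) \sum_(s : n.-tuple G | max_end_string s)
     (1 - end_coef s) * D s v].

(* f = F_1 and f :: F = F_1, ..., F_k with k >= 2; a1, a2 are attached to F_1
   and b1, b2 to F_k. *)
Definition lc_graph : Prop :=
  exists (f : G) (F : seq G) (a1 a2 b1 b2 : G),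
    [/\ F != [::],
        perm_eq ((f :: F) ++ [:: a1; a2; b1; b2]) (enum G),
        edges_are (path_edges (f :: F) ++
          [:: (a1, f); (a2, f); (b1, last f F); (b2, last f F)]),
        forall x, x \in f :: F ->
          genus x = 0%N /\ forall i, foot G i != x
      & forall x, x \in [:: a1; a2; b1; b2] ->
          genus x = 0%N /\
          ((dot x x = -1 /\
            exists i, [/\ foot G i = x, c (val i) = 1 / 2
                        & forall j, foot G j = x -> j = i]) \/
           (dot x x = -2 /\ forall i, foot G i != x))].

End Pair.

Section Dominance.
Variable I : finType.

(* Dual graph after blowing up a point: [m] is the set of exceptional curves
   through the point, [t] the set of strict transforms through it, and [None]
   is the new curve. *)
Definition blowup (G : dual_graph I) (m : pred G) (t : pred I) : dual_graph I :=
  @DualGraph I (option G)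
    (fun x => if x is Some v then genus v else 0%N)
    (fun x y => match x, y with
      | Some v, Some w => dot v w - (m v : nat)%:Z * (m w : nat)%:Z
      | Some v, None | None, Some v => (m v : nat)%:Z
      | None, None => -1
      end)
    (fun i => if t i then None else Some (foot G i)).

(* The points of E: a point on one E_v only, a crossing of two components,
   and the point of E on a strict transform. *)
Inductive blowup_center (G : dual_graph I) : pred G -> pred I -> Prop :=
| general_point v : blowup_center (pred1 v) pred0
| crossing_point x y : x != y -> 0 < dot x y -> blowup_center (pred2 x y) pred0
| foot_point i : blowup_center (pred1 (foot G i)) (pred1 i).

Definition graph_iso (G H : dual_graph I) : Prop :=
  exists h : G -> H,
    [/\ bijective h, forall x, genus (h x) = genus x,
        forall x y, dot (h x) (h y) = dot x y
      & forall i, foot H i = h (foot G i)].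

(* A resolution dominates another one iff it is obtained from it by a sequence
   of point blow-ups. *)
Inductive dominates (G : dual_graph I) : dual_graph I -> Prop :=
| dominates_iso H : graph_iso G H -> dominates G H
| dominates_blowup H m t :
    @blowup_center H m t -> dominates G (blowup m t) -> dominates G H.

Definition is_orbifold_log_resolution (G : dual_graph I) : Prop :=
  is_log_resolution G /\ is_orbifold G.

Definition minimal_orbifold_log_resolution (G : dual_graph I) : Prop :=
  is_orbifold_log_resolution G /\
  forall H, is_orbifold_log_resolution H -> dominates G H -> graph_iso G H.

End Dominance.

(* Main.v *)
(* On a maximal end string the equations D . E_j = 0 (j < s) make every coefficient
   of D an integer multiple of the first one, and D . E_s = -1 then shows that the
   first coefficient is 1/n for an integer n >= 1.  Minimality forbids contracting
   a (-1)-curve of a string, except when the string is a single (-1)-curve met by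
   some C~_i; so either n >= 2 or c_i >= 1/2, and every weight (1 - c_i)/n is at
   most 1/2.  If v lies on no string, write k for the number of its intersections
   with other such curves and m for the number of strings attached to it.  Then
     (K + E + sum c_i C~_i - N) . E_v >= 2g - 2 + k + m/2 >= 0,
   because k = 0 would make the graph star-shaped.
   If (X, C) is log canonical, the positive part P is nef, hence anti-effective,
   while it is >= 0 at the curves outside the strings, where N vanishes.  So P = 0
   by connectedness and all these inequalities are equalities, which leaves only
   (k, m) = (2, 0), or (k, m) = (1, 2) with both weights equal to 1/2. *)
Require Import Defs.
From mathcomp Require Import all_boot all_order all_algebra.
From mathcomp Require Import zify ring lra.
Import Order.TTheory GRing.Theory Num.Theory.
Local Open Scope ring_scope.

(* The same sum may occur with different (convertible) instances of the
   additive structure of [int], which [lia] would treat as distinct atoms. *)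
Ltac sum_lia :=
  repeat match goal with
  | |- context [@bigop.body ?R ?J ?i ?r ?F] =>
      first
        [ match goal with S := _ : int |- _ =>
            change (@bigop.body R J i r F) with S
          end
        | let S := fresh "S" in
          pose (S := (@bigop.body R J i r F : int));
          change (@bigop.body R J i r F) with S ]
  end;
  repeat match goal with S := _ : int |- _ => clearbody S end;
  lia.

(** * Chains of curves with respect to a symmetric intersection form *)

Section Chains.
Set Implicit Arguments.
Unset Strict Implicit.
Unset Printing Implicit Defensive.

Variables (I : finType) (G : dual_graph I).
Implicit Types (x y z f : G) (s r : seq G).

Lemma linked_cons (p : G * G) es x y :
  linked (p :: es) x y = [|| (x, y) == p, (y, x) == p | linked es x y].
Proof. by rewrite /linked !inE -!orbA; do !bool_congr. Qed.

Lemma linked_sym (es : seq (G * G)) x y : linked es x y = linked es y x.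
Proof. by rewrite /linked orbC. Qed.

Lemma path_edges_cons x y s : path_edges (x :: y :: s) = (x, y) :: path_edges (y :: s).
Proof. by []. Qed.

Lemma linked_path_mem s x y : linked (path_edges s) x y -> (x \in s) && (y \in s).
Proof.
elim: s x y => [|a [|b s] IH] x y //.
rewrite path_edges_cons linked_cons => /or3P[/eqP[-> ->]|/eqP[-> ->]|/IH].
- by rewrite !inE !eqxx !orbT.
- by rewrite !inE !eqxx !orbT.
- by case/andP=> hx hy; rewrite !(in_cons a) hx hy !orbT.
Qed.

Lemma linked_head y r v : y \notin r ->
  linked (path_edges (y :: r)) y v = (ohead r == Some v).
Proof.
case: r => [|b r]; first by [].
rewrite inE => /norP[yb yr].
rewrite path_edges_cons linked_cons !xpair_eqE eqxx /= (negbTE yb) andbF /=.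
have -> : (Some b == Some v) = (v == b) by rewrite eq_sym.
case E : (linked _ _ _); last by rewrite orbF.
by move/linked_path_mem: E; rewrite inE (negbTE yb) (negbTE yr).
Qed.

Lemma linked_mid f s1 y r v : uniq (f :: s1 ++ y :: r) ->
  linked (path_edges (f :: s1 ++ y :: r)) y v = (v == last f s1) || (ohead r == Some v).
Proof.
elim: s1 f => [|a s1 IH] f.
  rewrite cat0s path_edges_cons => /and3P[]; rewrite inE => /norP[fy fr] yr ur.
  by rewrite linked_cons !xpair_eqE eqxx andbT eq_sym (negbTE fy) linked_head.
rewrite !cat_cons path_edges_cons => /andP[fn u].
rewrite linked_cons IH // !xpair_eqE.
have /negbTE ya : y != a.
  by move: u => /=; rewrite mem_cat inE => /andP[/norP[_ /norP[]]]; rewrite eq_sym.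
have /negbTE yf : y != f.
  move: fn; rewrite inE mem_cat inE => /norP[_ /norP[_ /norP[h _]]].
  by rewrite eq_sym.
by rewrite ya yf andbF.
Qed.

Lemma linked_behead f z s x v : x != f -> x != z ->
  linked (path_edges (f :: z :: s)) x v = linked (path_edges (z :: s)) x v.
Proof.
move=> xf xz; rewrite path_edges_cons linked_cons !xpair_eqE.
by rewrite (negbTE xf) (negbTE xz) andbF.
Qed.

Lemma sum_ge1 (P : pred G) (F : G -> int) : (forall x, P x -> 0 <= F x) ->
  0 < \sum_(x | P x) F x -> exists2 y, P y & 0 < F y.
Proof.
move=> F0 F1; case: (pickP [pred y | P y & 0 < F y]) => [y /andP[]|h]; first by exists y.
move: F1; rewrite big1 ?ltxx // => x Px; apply/eqP.
by move: (h x); rewrite /= Px /= lt0r F0 // andbT => /negbFE.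
Qed.

Lemma sum_eq1 (P : pred G) (F : G -> int) : (forall x, P x -> 0 <= F x) ->
  \sum_(x | P x) F x = 1 ->
  exists2 y, P y & F y = 1 /\ forall x, P x -> x != y -> F x = 0.
Proof.
move=> F0 F1; have [|y Py Fy] := sum_ge1 F0; first by rewrite F1.
have F0' x : P x && (x != y) -> 0 <= F x by case/andP=> /F0.
exists y => //; move: F1; rewrite (bigD1 y) //= => F1.
have s0 : \sum_(i | P i && (i != y)) F i = 0 :> int.
  have : 0 <= \sum_(i | P i && (i != y)) F i by apply: sumr_ge0.
  by move: Fy F1; sum_lia.
split; first by move: F1; rewrite s0 addr0.
move=> x Px xy; apply: (psumr_eq0P F0' s0); exact/andP.
Qed.

Lemma chain_uniq_mid f s1 y r : uniq (f :: s1 ++ y :: r) -> last f s1 \notin y :: r.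
Proof.
rewrite -cat_cons cat_uniq => /and3P[_ /hasPn h _].
by apply/negP=> /h; rewrite /= mem_last.
Qed.

Variable d : G -> G -> int.
Hypothesis d_sym : forall x y, d x y = d y x.
Hypothesis d_ge0 : forall x y, x != y -> 0 <= d x y.

(** Only the curves of [s] are constrained: [f] may meet further curves outside the chain. The form
    [d] is abstract because these lemmas are applied both to [dot] and to its restriction
    [core_dot]. *)
Definition chain_ending f s :=
  [/\ uniq (f :: s), s != [::] &
    forall x, x \in s -> forall y, y != x ->
      d x y = (linked (path_edges (f :: s)) x y : nat)%:Z].

Lemma chain_dot f s1 y r v : chain_ending f (s1 ++ y :: r) -> v != y ->
  d y v = ((v == last f s1) || (ohead r == Some v) : nat)%:Z.
Proof.
case=> u _ h vy; rewrite h // ?linked_mid //.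
by rewrite mem_cat mem_head orbT.
Qed.

Lemma chain_valence f s1 y r : chain_ending f (s1 ++ y :: r) ->
  \sum_(w | w != y) d y w = 1 + (r != [::] : nat)%:Z.
Proof.
move=> ch; have [u _ _] := ch.
have := chain_uniq_mid u; rewrite inE => /norP[ly lr].
have yr : y \notin r by move: u => /= /andP[_]; rewrite cat_uniq => /and3P[_ _] /andP[].
rewrite (bigD1 (last f s1)) //= (chain_dot ch ly) eqxx /=; congr (_ + _).
case: r ch u lr yr => [|z r] ch u lr yr /=.
  rewrite big1 // => w /andP[wy wl].
  by rewrite (chain_dot ch wy) (negbTE wl).
move: lr yr; rewrite !inE => /norP[lz _] /norP[yz _].
rewrite (bigD1 z) /=; last by rewrite eq_sym yz eq_sym lz.
rewrite (chain_dot ch) 1?eq_sym //= eqxx orbT big1 ?addr0 // => w /andP[/andP[wy wl] wz].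
rewrite (chain_dot ch wy) (negbTE wl) /=; case: eqP => // -[] /esym/eqP.
by rewrite (negbTE wz).
Qed.

Lemma chain_ending_head f y r : chain_ending f (y :: r) ->
  [/\ f != y, d f y = 1 & forall w, w != f -> w != y -> w \in r -> d f w = 0].
Proof.
case=> u _ h; have fy : f != y by case/andP: u; rewrite inE => /norP[].
have lk w : linked (path_edges (f :: y :: r)) f w = (w == y).
  by rewrite linked_head 1?eq_sym //; case/andP: u.
split=> //; first by rewrite d_sym h ?mem_head // linked_sym lk eqxx.
move=> w wf wy wr; rewrite d_sym h 1?eq_sym //; first by rewrite linked_sym lk (negbTE wy).
by rewrite inE wr orbT.
Qed.

(** One of the two intersections of [f] is with the head of [s]; the other singles out the next
    curve, which is new because [f] meets no later curve of [s]. *)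
Lemma chain_extend f s : chain_ending f s -> \sum_(y | y != f) d f y = 2 ->
  exists2 y, y \notin f :: s & chain_ending y (f :: s).
Proof.
case: s => [[]//|y r] ch; have [fy dfy dfr] := chain_ending_head ch.
rewrite (bigD1 y) 1?eq_sym //= dfy => /(_ =P _) e2.
have {}e2 : \sum_(i | (i != f) && (i != y)) d f i = 1 :> int by move: e2 => /eqP; sum_lia.
have [|z /andP[zf zy] [dfz dz]] := sum_eq1 _ e2.
  by move=> x /andP[xf _]; rewrite d_ge0 // eq_sym.
have zn : z \notin f :: y :: r.
  by rewrite !inE (negbTE zf) (negbTE zy) /=; apply/negP=> /(dfr _ zf zy); rewrite dfz.
case: ch => u _ h; exists z => //; split=> //; first by rewrite cons_uniq zn.
move=> x; rewrite inE => /orP[/eqP-> w wf|xs w wx].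
  rewrite path_edges_cons linked_cons !xpair_eqE eqxx eq_sym (negbTE zf) andbT /=.
  rewrite linked_head; last by case/andP: u.
  have -> : (ohead (y :: r) == Some w) = (w == y) by rewrite eq_sym.
  case: (eqVneq w z) => [->|wz] /=; first by rewrite dfz.
  case: (eqVneq w y) => [->|wy] /=; first by rewrite dfy.
  by rewrite dz // wf.
rewrite h // [in RHS]linked_behead //.
  by apply: contraNneq zn => <-; rewrite inE xs orbT.
by case/andP: u => /negP fn _; apply/eqP=> e; apply: fn; rewrite -e.
Qed.

(** The chain is prolonged at its front, so its last curve stays fixed. Each step adds a new curve,
    hence [#|G| - size s] decreases. *)
Lemma chain_walk (stop : pred G) f s : chain_ending f s -> {in s, forall x, ~~ stop x} ->
  exists z s', [/\ chain_ending z s', last z s' = last f s, {in s', forall x, ~~ stop x}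
     & stop z || (\sum_(y | y != z) d z y != 2)].
Proof.
have [n] := ubnP (#|G| - size s); elim: n f s => // n IH f s lt ch hs.
case: (boolP (stop f || (\sum_(y | y != f) d f y != 2))) => [h|].
  by exists f, s.
rewrite negb_or negbK => /andP[nst /eqP/(chain_extend ch)[y yn ch']].
have [||z [s' [c1 c2 c3 c4]]] := IH y (f :: s) _ ch'.
- case: ch' => /card_uniqP e _ _; have := max_card [in y :: f :: s]; rewrite e /=.
  by move: lt => /=; lia.
- by move=> x; rewrite inE => /orP[/eqP->|/hs].
by exists z, s'.
Qed.

Lemma chain_start e : \sum_(y | y != e) d e y = 1 -> exists f, chain_ending f [:: e].
Proof.
move=> h; have [|f fe [d1 d0]] := sum_eq1 _ h.
  by move=> x xe; rewrite d_ge0 // eq_sym.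
exists f; split=> //; first by rewrite /= inE fe.
move=> x; rewrite inE => /eqP-> y ye.
rewrite path_edges_cons linked_cons !xpair_eqE eqxx andbT /linked !in_nil !orbF eq_sym (negbTE fe).
by case: (eqVneq y f) => [->|yf]; [rewrite d1|rewrite d0].
Qed.

(** The head of [s] uses up the only intersection of [z], so the condition on the curves of [s]
    extends to [z]. *)
Lemma chain_closed z s : chain_ending z s -> \sum_(y | y != z) d z y = 1 ->
  forall x y, x \in z :: s -> x != y -> d x y = (linked (path_edges (z :: s)) x y : nat)%:Z.
Proof.
case: s => [[]//|a r] ch; have [za dza _] := chain_ending_head ch.
rewrite (bigD1 a) 1?eq_sym //= dza => e2 x y xs xy.
have {}e2 : \sum_(i | (i != z) && (i != a)) d z i = 0 :> int by move: e2; sum_lia.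
case: (ch) => u _ h; move: xs; rewrite in_cons => /orP[/eqP xz|/h]; last by apply; rewrite eq_sym.
rewrite {x}xz in xy *; rewrite linked_head; last by case/andP: u.
case: (eqVneq y a) => [->|ya]; first by rewrite dza eqxx.
have -> : (ohead (a :: r) == Some y) = false.
  by rewrite eq_sym; apply/eqP=> -[] /eqP; rewrite (negbTE ya).
apply: (psumr_eq0P _ e2); last by rewrite eq_sym xy.
by move=> i /andP[iz _]; rewrite d_ge0 // eq_sym.
Qed.
Lemma linked_cat (es1 es2 : seq (G * G)) x y :
  linked (es1 ++ es2) x y = linked es1 x y || linked es2 x y.
Proof. by rewrite /linked !mem_cat orbACA. Qed.

(** With every pendant edge listed leaf first, distinct first entries leave only one edge at [x]. *)
Lemma linked_pendant (es : seq (G * G)) x f y : uniq (map fst es) -> (x, f) \in es ->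
  (forall p, p \in es -> p.2 != x) -> linked es x y = (y == f).
Proof.
move=> u xf nx; rewrite /linked orbC; have /negbTE-> /= : (y, x) \notin es.
  by apply/negP=> /nx; rewrite eqxx.
apply/idP/eqP => [xy|->//]; elim: es u xf xy {nx} => //= p es IH /andP[pn u].
rewrite !inE => /orP[/eqP pf|xf] /orP[/eqP py|xy].
- by move: py; rewrite -pf => -[].
- by move: pn; rewrite -pf (map_f fst xy).
- by move: pn; rewrite -py (map_f fst xf).
- exact: IH.
Qed.
End Chains.

(** * Maximal end strings: disjointness, enumeration, existence at rational end curves *)

Section EndStrings.
Set Implicit Arguments.
Unset Strict Implicit.
Unset Printing Implicit Defensive.

Variables (I : finType) (G : dual_graph I).
Implicit Types (x y z f : G) (s r : seq G).
Hypothesis HG : is_log_resolution G.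

Let d_sym x y : dot x y = dot y x. Proof. by case: HG. Qed.
Let d_ge0 x y : x != y -> 0 <= dot x y. Proof. by case: HG => _ h _ _; apply: h. Qed.

Definition end_string_at f s : Prop :=
  [/\ chain_ending (@dot I G) f s, forall x, x \in s -> genus x = 0%N
    & (0 < genus f)%N || (3 <= valence f)].

Lemma max_end_stringP s : reflect (exists f, end_string_at f s) (max_end_string s).
Proof.
apply: (iffP andP) => [[/andP[s0 /allP g0] /existsP[f]]|[f [[u s0 h] g0 gv]]].
  case/and3P=> u gv /allP h; exists f; split=> //; last by move=> x /g0/eqP.
  split=> // x /h /forallP hx y yx; apply/eqP; exact: (implyP (hx y)).
rewrite s0; split; first by apply/allP=> x /g0->.
apply/existsP; exists f; rewrite u gv /=; apply/allP=> x xs.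
by apply/forallP=> y; apply/implyP=> yx; rewrite h.
Qed.

Lemma end_string_valence f s x : end_string_at f s -> x \in s ->
  genus x = 0%N /\ valence x = 1 + (x != last x s : nat)%:Z.
Proof.
case=> ch g0 _ xs; split; first exact: g0.
case: (splitPr xs) ch => s1 r ch; rewrite /valence (chain_valence ch) last_cat /=.
case: (lastP r) ch => [|r' z] ch; first by rewrite /= eqxx.
rewrite last_rcons; case: ch => u _ _; congr (_ + Posz (nat_of_bool _)).
move: u; rewrite /= cat_uniq /= mem_rcons inE => /andP[_ /and3P[_ _ /andP[]]].
by case/norP=> ->; case: (r').
Qed.

(** String curves are rational of valence at most 2, which excludes the curve to which a string is
    attached. *)
Lemma end_string_foreign f s f' s' : end_string_at f s -> end_string_at f' s' -> f \notin s'.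
Proof.
move=> h h'; apply/negP=> /(end_string_valence h')[g v].
by case: h => _ _; rewrite g v; case: (_ != _).
Qed.

(** Moving along [s] towards its end, the next curve meets a curve of [s']; so it lies in
    [f' :: s'], and it is not [f'] by [end_string_foreign]. *)
Lemma end_string_last f s f' s' x : end_string_at f s -> end_string_at f' s' ->
  x \in s -> x \in s' -> last x s \in s'.
Proof.
move=> h h' xs; case: (splitPr xs) h => s1 r; rewrite last_cat /=.
elim: r s1 x {xs} => [|y r IH] s1 x h xs' //=.
have h2 : end_string_at f ((s1 ++ [:: x]) ++ y :: r) by rewrite -catA.
apply: (IH _ _ h2); have [ch _ _] := h; have [ch' _ _] := h'.
have yx : y != x.
  case: ch => /= /andP[_]; rewrite cat_uniq => /and3P[_ _ /= /andP[]].
  by rewrite inE eq_sym => /norP[].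
have := chain_dot ch yx; rewrite /= eqxx orbT => dxy.
case: ch' => _ _ /(_ x xs' y yx); rewrite dxy; case E: (linked _ _ _) => // _.
have /andP[_] := linked_path_mem E; rewrite inE => /orP[/eqP e|//].
by have := end_string_foreign h' h; rewrite -e mem_cat !inE eqxx !orbT.
Qed.

(** The comparison runs backwards from the common tail: the intersection numbers of [y] determine
    its predecessor. If one prefix is exhausted first, its attaching curve would lie on the other
    string. *)
Lemma end_string_same_end f f' s1 s1' y r :
  end_string_at f (s1 ++ y :: r) -> end_string_at f' (s1' ++ y :: r) -> s1 = s1'.
Proof.
elim/last_ind: s1 s1' y r => [|s1 x IH] s1' y r h h'.
  case/lastP: s1' h' => [//|s1' x'] h'; exfalso.
  have [ch _ _] := h; have [ch' _ _] := h'.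
  have [u _ _] := ch; have := chain_uniq_mid u; rewrite inE /= => /norP[fy fr].
  have := chain_dot ch fy; rewrite (chain_dot ch' fy) /= eqxx last_rcons.
  have -> /= : (ohead r == Some f) = false.
    by apply/eqP; case: (r) fr => //= a r'; rewrite inE => /norP[af _] [e]; rewrite e eqxx in af.
  rewrite orbF; case: eqP => // e _.
  by have := end_string_foreign h h'; rewrite e mem_cat mem_rcons mem_head.
have [ch _ _] := h; have [ch' _ _] := h'.
have [u _ _] := ch; have := chain_uniq_mid u; rewrite inE last_rcons => /norP[xy xr].
have := chain_dot ch xy; rewrite (chain_dot ch' xy) last_rcons eqxx /=.
have -> /= : (ohead r == Some x) = false.
  by apply/eqP; case: (r) xr => //= a r'; rewrite inE => /norP[af _] [e]; rewrite e eqxx in af.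
rewrite orbF; case: eqP => // e _.
case/lastP: s1' h' ch' e => [|s1' x'] h' ch'; rewrite ?last_rcons /= => e.
  by have := end_string_foreign h' h; rewrite -e mem_cat mem_rcons mem_head.
by subst x'; rewrite (IH s1' x (y :: r)) // -cat_rcons.
Qed.

Lemma end_string_unique f s f' s' x : end_string_at f s -> end_string_at f' s' ->
  x \in s -> x \in s' -> s = s'.
Proof.
move=> h h' xs xs'; have l := end_string_last h h' xs xs'.
set e := last x s in l.
have es : e \in s by rewrite /e; case: (s) xs => [//|a r] _ /=; exact: mem_last.
(* The end of [s] has valence 1, and on [s'] only the last curve has valence 1. *)
have le : last e s' = e.
  have [_ v] := end_string_valence h es; have [_ v'] := end_string_valence h' l.
  have ee : last e s = e by rewrite /e; case: (s) xs.
  by move: v; rewrite v' ee eqxx; case: eqP.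
have [r0 es0] : exists s1, s = s1 ++ [:: e].
  exists (belast (head x s) (behead s)).
  by rewrite cats1 /e; case: (s) xs => //= a r _; rewrite -lastI.
have [r1 es1] : exists s1, s' = s1 ++ [:: e].
  exists (belast (head x s') (behead s')); rewrite cats1 -[in rcons _ _]le.
  by case: (s') xs' => //= a r _; rewrite -lastI.
by move: h h'; rewrite es0 es1 => h h'; rewrite (end_string_same_end h h').
Qed.

(** The index set of [end_string_sum], flattened into one list so that sums over strings become sums
    over a duplicate-free sequence. *)
Definition end_strings : seq (seq G) :=
  [seq @tval n G t | n <- iota 0 #|G|.+1, t <- enum [pred t : n.-tuple G | max_end_string t]].

Lemma mem_end_strings s : (s \in end_strings) = max_end_string s.
Proof.
apply/allpairsPdep/idP => [[n [t [_]]]|ms]; first by rewrite mem_enum => h ->.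
have lt : (size s < #|G|.+1)%N.
  have [f [[u _ _] _ _]] := max_end_stringP _ ms.
  by rewrite ltnS; move: u => /= /andP[_ /card_uniqP <-]; exact: max_card.
by exists (size s), (in_tuple s); rewrite mem_iota mem_enum; split.
Qed.

Lemma uniq_end_strings : uniq end_strings.
Proof.
apply: allpairs_uniq_dep; first exact: iota_uniq.
  by move=> n _; exact: enum_uniq.
move=> [n t] [n' t'] _ _ /= e.
have en : n = n' by rewrite -(size_tuple t) -(size_tuple t') e.
by move: t e; rewrite en => t e; congr existT; exact: val_inj.
Qed.

Lemma sum_end_strings (F : seq G -> rat) :
  \sum_(n < #|G|.+1) \sum_(s : n.-tuple G | max_end_string s) F s =
  \sum_(s <- end_strings) F s.
Proof.
rewrite -(big_mkord xpredT
  (fun n => \sum_(s : n.-tuple G | max_end_string s) F s)) /index_iota subn0.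
by rewrite /end_strings big_allpairs_dep; apply: eq_bigr => n _; rewrite big_enum.
Qed.

Lemma end_stringsP s : reflect (exists f, end_string_at f s) (s \in end_strings).
Proof. by rewrite mem_end_strings; exact: max_end_stringP. Qed.

Lemma end_strings_disjoint s s' x : s \in end_strings -> s' \in end_strings ->
  x \in s -> x \in s' -> s = s'.
Proof. by move=> /end_stringsP[f h] /end_stringsP[f' h']; exact: end_string_unique h h'. Qed.

Lemma uniq_flatten_strings ss : uniq ss -> {subset ss <= end_strings} -> uniq (flatten ss).
Proof.
elim: ss => [//|s ss IH] /= /andP[sn un] sub.
have sE : s \in end_strings by apply: sub; exact: mem_head.
have us : uniq s by have /end_stringsP[f [[/andP[]]]] := sE.
rewrite cat_uniq us IH ?andbT //; last by move=> t h; apply: sub; rewrite inE h orbT.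
apply/hasPn=> x /flattenP[t tss xt]; apply/negP=> xs.
have tE : t \in end_strings by apply: sub; rewrite inE tss orbT.
by move: sn; rewrite (end_strings_disjoint sE tE xs xt) tss.
Qed.

Lemma connected_ind (P : pred G) x : P x ->
  (forall a b, P a -> a != b -> dot a b != 0 -> P b) -> forall y, P y.
Proof.
move=> Px h y; have [_ _ _ /(_ x y)/connectP[p]] := HG.
elim: p x Px => [|z p IH] x Px /=; first by move=> _ ->.
by case/andP=> /andP[xz dxz]; apply: IH; exact: h Px xz dxz.
Qed.

(** The walk from [e] stops at a curve of positive genus or of valence other than 2. If that curve
    were rational of valence below 3, its valence would be 1, and by connectedness the chain would
    be all of E, hence star-shaped. *)
Lemma end_curve_in_string e : ~ star_shaped G -> genus e = 0%N -> valence e = 1 ->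
  exists2 s, s \in end_strings & last_of s e.
Proof.
move=> ns ge ve; have [f ch] := chain_start d_ge0 ve.
have [|z [s [c1 c2 c3 c4]]] := chain_walk d_sym d_ge0 (stop := fun x => genus x != 0%N) ch.
  by move=> x; rewrite inE => /eqP->; rewrite negbK ge.
have sn : s != [::] by case: c1.
have le : last e s = e by move: c2 sn; rewrite /=; case: (s).
have es : e \in s by rewrite -[X in X \in _]le; case: (s) sn => //= a r _; exact: mem_last.
have dz : 1 <= valence z.
  case: (s) c1 sn => //= a r c1 _; have [za dza _] := chain_ending_head d_sym c1.
  rewrite /valence (bigD1 a) 1?eq_sym //= dza lerDl; apply: sumr_ge0 => i /andP[iz _].
  by rewrite d_ge0 // eq_sym.
case: (boolP ((0 < genus z)%N || (3 <= valence z))) => hz.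
  exists s; last by rewrite /last_of es le eqxx.
  apply/end_stringsP; exists z; split=> // x /c3; rewrite negbK => /eqP //.
exfalso; apply: ns; move: hz; rewrite negb_or -leqNgt leqn0 => /andP[/eqP gz].
move: c4; rewrite gz /= -/(valence z) => v2 v3.
have v1 : valence z = 1 by move: v2 v3 dz; rewrite /= -/(valence z); lia.
have cl := chain_closed d_sym d_ge0 c1 v1.
have all y : y \in z :: s.
  apply: (connected_ind (P := [in z :: s]) (x := z)); first exact: mem_head.
  move=> a b az ab dab; move: dab; rewrite (cl _ _ az ab).
  by case E: (linked _ _ _) => // _; case/andP: (linked_path_mem E).
exists z, [:: s]; rewrite /= !cats0; split.
- apply: uniq_perm; [by case: c1|exact: enum_uniq|].
  by move=> y; rewrite all mem_enum.
- by move=> x /c3; rewrite negbK => /eqP.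
- by move=> x y xy; exact: cl.
Qed.

End EndStrings.

(** * Negative definiteness, and the coefficients of the string cycles *)

Section IntersectionForm.
Set Implicit Arguments.
Unset Strict Implicit.
Unset Printing Implicit Defensive.

Variables (I : finType) (G : dual_graph I).
Implicit Types (x y z f v w : G) (s r : seq G) (Z P : {ffun G -> rat}).
Hypothesis HG : is_log_resolution G.

Let d_sym x y : dot x y = dot y x. Proof. by case: HG. Qed.
Let d_ge0 x y : x != y -> 0 <= dot x y. Proof. by case: HG => _ h _ _; apply: h. Qed.

Lemma edotD Z P v : edot (Z + P) v = edot Z v + edot P v.
Proof. by rewrite /edot -big_split; apply: eq_bigr => w _; rewrite ffunE mulrDl. Qed.

Lemma edotN Z v : edot (- Z) v = - edot Z v.
Proof. by rewrite /edot -sumrN; apply: eq_bigr => w _; rewrite ffunE mulNr. Qed.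

Lemma edot_one v : edot [ffun=> 1] v = dotE G v.
Proof. by rewrite /edot /dotE; apply: eq_bigr => w _; rewrite ffunE mul1r. Qed.

Lemma dotE_valence v : dotE G v = (valence v + dot v v)%:~R.
Proof.
rewrite /dotE (bigD1 v) //= rmorphD /= addrC; congr (_ + _).
by rewrite /valence rmorph_sum; apply: eq_bigr => w _; rewrite d_sym.
Qed.

Lemma dot_self_lt0 v : dot v v < 0.
Proof.
case: HG => _ _ nd _; have := nd [ffun w => (w == v)%:R].
have e w : edot [ffun w0 => (w0 == v)%:R] w = (dot v w)%:~R.
  rewrite /edot (bigD1 v) //= ffunE eqxx mul1r big1 ?addr0 // => u /negbTE uv.
  by rewrite ffunE uv mul0r.
rewrite (bigD1 v) //= e ffunE eqxx mul1r big1 ?addr0.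
  rewrite ltrz0; apply; apply/eqP=> /ffunP/(_ v); rewrite !ffunE eqxx => /eqP.
  by rewrite oner_eq0.
by move=> u /negbTE uv; rewrite ffunE uv mul0r.
Qed.

(** Let [N] be the negative part of [Z]. Then N.(Z + N) >= 0, as both are effective without common
    component, while N.Z <= 0 by hypothesis. So N.N >= 0, and definiteness gives [N = 0]. *)
Lemma antinef_on_support_ge0 Z : (forall v, Z v < 0 -> edot Z v <= 0) -> forall v, 0 <= Z v.
Proof.
move=> h.
pose N : {ffun G -> rat} := [ffun v => if Z v < 0 then - Z v else 0].
have N0 v : 0 <= N v by rewrite ffunE; case: ltP => // /ltW; rewrite oppr_ge0.
have Z0 v : 0 <= Z v + N v.
  by rewrite ffunE; case: ltP => // zv; rewrite ?subrr ?addr0.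
have e v : edot N v = edot (Z + N) v - edot Z v by rewrite edotD addrC addKr.
have NE : N = 0.
  apply/eqP/contraT=> nN; case: HG => _ _ /(_ _ nN) lt _; move: lt.
  rewrite ltNge sumr_ge0 // => v _; rewrite e mulrBr subr_ge0.
  apply: (@le_trans _ _ 0).
    have [zv|zv] := ltP (Z v) 0; first by rewrite mulr_ge0_le0 // h.
    by rewrite ffunE ltNge zv /= mul0r.
  rewrite mulr_sumr sumr_ge0 // => w _.
  have [->|wv] := eqVneq w v.
    by rewrite !ffunE; case: ltP => zv; rewrite ?subrr ?mul0r ?mulr0.
  by rewrite !mulr_ge0 // ?ler0z ?d_ge0 // ffunE.
move=> v; have := congr1 (fun F : {ffun G -> rat} => F v) NE; rewrite !ffunE.
by case: ltP => // zv e0; move: zv; rewrite -oppr_gt0 e0 ltxx.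
Qed.

Lemma nef_le0 P : (forall v, 0 <= edot P v) -> forall v, P v <= 0.
Proof.
move=> h v; have := @antinef_on_support_ge0 (- P) _ v; rewrite ffunE oppr_ge0; apply.
by move=> w _; rewrite edotN oppr_le0.
Qed.

Lemma edot_inj Z P : (forall v, edot Z v = edot P v) -> Z = P.
Proof.
move=> h; apply/eqP; rewrite -subr_eq0; apply/contraT=> nz.
case: HG => _ _ /(_ _ nz) lt _; move: lt; rewrite big1 ?ltxx // => v _.
by rewrite edotD edotN h subrr mulr0.
Qed.

(** The numerical convention: a definite intersection matrix is invertible, so every system of
    intersection numbers is realised. *)
Lemma equiv_to_exists (l : G -> rat) : exists L, equiv_to L l.
Proof.
pose M : 'M[rat]_#|G| := \matrix_(i, j) (dot (enum_val i) (enum_val j))%:~R.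
pose toZ (u : 'rV[rat]_#|G|) : {ffun G -> rat} := [ffun v => u 0 (enum_rank v)].
have e u v : edot (toZ u) v = (u *m M) 0 (enum_rank v).
  rewrite /edot mxE (reindex (@enum_rank G)) /=.
    by apply: eq_bigr => w _; rewrite ffunE !mxE !enum_rankK.
  by exists enum_val => w _; rewrite ?enum_rankK ?enum_valK.
have Mu : M \in unitmx.
  rewrite unitmxE unitfE; apply/det0P=> -[u u0 uM]; move: u0; apply/negP; rewrite negbK.
  have Z0 : toZ u = 0.
    apply: edot_inj => v; rewrite e uM mxE /edot big1 // => w _.
    by rewrite ffunE mul0r.
  apply/eqP/rowP=> i; have := congr1 (fun F : {ffun G -> rat} => F (enum_val i)) Z0.
  by rewrite !ffunE enum_valK mxE.
exists (toZ ((\row_i l (enum_val i)) *m invmx M)) => v.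
by rewrite e mulmxKV // mxE enum_rankK.
Qed.

Lemma end_string_head f s : end_string_at f s -> head f s \in s.
Proof. by case=> -[_ s0 _] _ _; case: s s0 => // a r _; exact: mem_head. Qed.

Lemma end_string_dot_outside f s v w : end_string_at f s -> w \in s -> v \notin s ->
  dot w v = ((w == head f s) && (v == f) : nat)%:Z.
Proof.
move=> [[u s0 h] _ _] ws vs; rewrite h //; last by apply: contraNneq vs => ->.
congr (Posz (nat_of_bool _)); case: s s0 u h ws vs => // a r _ u h ws vs.
have fn : f \notin a :: r by case/andP: u.
rewrite linked_sym; have [->|vf] := eqVneq v f.
  by rewrite linked_head //= andbT; apply/eqP/eqP=> [[->]|->].
rewrite andbF; apply/negP=> /linked_path_mem; rewrite inE (negbTE vf) /=.
by rewrite (negbTE vs).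
Qed.

Lemma edot_string_outside f s Z v : end_string_at f s -> (forall v, v \notin s -> Z v = 0) ->
  v \notin s -> edot Z v = Z (head f s) * (v == f)%:R.
Proof.
move=> h Z0 vs; have hs := end_string_head h.
rewrite /edot (bigD1 (head f s)) //= (end_string_dot_outside h) // eqxx /=.
rewrite big1 ?addr0; first by case: (v == f).
move=> w wh; have [ws|ws] := boolP (w \in s); last by rewrite Z0 // mul0r.
by rewrite (end_string_dot_outside h) // (negbTE wh) mulr0.
Qed.

Lemma edot_string f s1 y r Z : end_string_at f (s1 ++ y :: r) ->
  edot Z y = Z y * (dot y y)%:~R + Z (last f s1) + (if r is z :: _ then Z z else 0).
Proof.
move=> [ch _ _]; have [u _ _] := ch; have := chain_uniq_mid u.
rewrite inE => /norP[ly lr].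
have yr : y \notin r by move: u => /= /andP[_]; rewrite cat_uniq => /and3P[_ _] /andP[].
rewrite /edot (bigD1 y) //= -addrA; congr (_ + _).
rewrite (bigD1 (last f s1)) //= d_sym (chain_dot ch ly) eqxx /= mulr1; congr (_ + _).
case: r ch u lr yr => [|z r] ch u lr yr /=.
  rewrite big1 // => w /andP[wy wl].
  by rewrite d_sym (chain_dot ch wy) (negbTE wl) mulr0.
move: lr yr; rewrite !inE => /norP[lz _] /norP[yz _].
rewrite (bigD1 z) /=; last by rewrite eq_sym yz eq_sym lz.
rewrite d_sym (chain_dot ch) 1?eq_sym //= eqxx orbT mulr1 big1 ?addr0 //.
move=> w /andP[/andP[wy wl] wz]; rewrite d_sym (chain_dot ch wy) (negbTE wl) /=.
have -> : (Some z == Some w) = false by apply/eqP=> -[] /esym/eqP; rewrite (negbTE wz).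
by rewrite mulr0.
Qed.

(* Along the string, D . E_j = 0 makes each coefficient of D an integer multiple
   [p] of the first one, and D . E_s = -1 then says that the last multiple is the
   inverse of the first coefficient. *)
Lemma string_cycle_recursion f s1 y r Z b (p0 p1 : int) :
  end_string_at f (s1 ++ y :: r) ->
  (forall v, v \in y :: r -> edot Z v = if last y r == v then -1 else 0) ->
  Z (last f s1) = p0%:~R * b -> Z y = p1%:~R * b ->
  exists n : int, [/\ n%:~R * b = 1,
    r = [::] -> n = - dot y y * p1 - p0
    & (forall v, v \in y :: r -> dot v v <= -2) -> 0 <= p0 < p1 -> p1 + (size r)%:Z < n].
Proof.
elim: r s1 y p0 p1 => [|z r IH] s1 y p0 p1 h hZ Z0 Z1.
  exists (- dot y y * p1 - p0).
  have := edot_string Z h; rewrite hZ ?mem_head //= eqxx Z0 Z1 => e; split=> //.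
    rewrite rmorphB rmorphM rmorphN /=; lra.
  by move=> /(_ y (mem_head _ _)); nia.
have h' : end_string_at f ((s1 ++ [:: y]) ++ z :: r) by rewrite -catA.
have yn : (last z r == y) = false.
  case: h => -[/= /andP[_ u] _ _] _ _; move: u; rewrite cat_uniq => /and3P[_ _ /= /andP[yn _]].
  by apply/eqP=> e; rewrite -e mem_last in yn.
have := edot_string Z h; rewrite hZ ?mem_head //= yn Z0 Z1 => e.
have [|||n [n1 n2 n3]] := IH _ z p1 (- dot y y * p1 - p0) h'.
- by move=> v vr; rewrite hZ // inE vr orbT.
- by rewrite last_cat.
- rewrite rmorphB rmorphM rmorphN /=; lra.
(* If [dot y y <= -2], the next multiple is at least [2 * p1 - p0], hence exceeds [p1]. The
   multiples grow strictly, by at least 1 for each curve. *)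
exists n; split=> // q p01; have qy := q y (mem_head _ _).
have := n3 (fun v vr => q v (mem_behead (s := y :: z :: r) vr)).
rewrite /=; nia.
Qed.

(** Negative coefficients can only occur on [s], where the intersection numbers are 0 or -1. *)
Lemma string_cycle_ge0 s Z v : string_cycle s Z -> 0 <= Z v.
Proof.
case=> Z0 hZ; apply: antinef_on_support_ge0 => w zw; have [ws|ws] := boolP (w \in s).
  by rewrite hZ //; case: ifP.
by rewrite Z0 // ltxx in zw.
Qed.

(** Here [n] is the continuant of the negated self-intersections, that is, the determinant of the
    negated intersection matrix of the string. *)
Lemma string_cycle_head f s Z : end_string_at f s -> string_cycle s Z ->
  exists n : nat, [/\ n%:R * Z (head f s) = 1,
    size s = 1%N -> dot (head f s) (head f s) = - n%:Z
    & (forall v, v \in s -> dot v v <= -2) -> (size s < n)%N].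
Proof.
move=> h cyc; have Zh := string_cycle_ge0 (head f s) cyc.
case: cyc => Z0 hZ; have fs : f \notin s by case: (h) => -[/andP[]].
case: s h Z0 hZ fs Zh => [|y r] h Z0 hZ fs Zh; first by case: h => -[].
(* The initial multiples are 0 at [f], which lies outside the support of [Z], and 1 at the first
   curve. *)
have [|||n [n1 n2 n3]] := @string_cycle_recursion f [::] y r Z (Z y) 0 1 h.
- move=> v vr; rewrite hZ //; congr (if _ then _ else _).
  by rewrite /last_of vr.
- by rewrite Z0 // mul0r.
- by rewrite mul1r.
have n0 : 0 <= n.
  rewrite -(ler0z rat); apply/contraT; rewrite -ltNge => nn; move: n1 => /= /eqP.
  have := mulr_le0_ge0 (ltW nn) Zh; rewrite /=; lra.
exists `|n|%N; split.
- by rewrite -[_%:R]/((`|n|%N : int)%:~R) gez0_abs.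
- by case: r n2 {h Z0 hZ fs Zh n3 n1} => //= /(_ erefl); lia.
- by move=> /n3 /(_ isT) /=; lia.
Qed.

End IntersectionForm.

(** * Contraction of a rational (-1)-curve *)

Section Contraction.
Set Implicit Arguments.
Unset Strict Implicit.
Unset Printing Implicit Defensive.

Variables (I : finType) (G : dual_graph I).
Hypothesis HG : is_log_resolution G.

Let d_sym (v w : G) : dot v w = dot w v. Proof. by case: HG. Qed.
Let d_ge0 (v w : G) : v != w -> 0 <= dot v w. Proof. by case: HG => _ h _ _; apply: h. Qed.

Let addz_neq0 (a b : int) : 0 <= a -> 0 <= b -> (a != 0) || (b != 0) -> a + b != 0.
Proof. lia. Qed.

Variables (x : G) (u : {v : G | v \in predC1 x}).
Hypothesis gx : genus x = 0%N.
Hypothesis xx : dot x x = -1.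
Hypothesis ux : dot (val u) x = 1.

(* The branches meeting E_x, if any, are transferred to the neighbour [u]: this
   is only meaningful when E_x is an end curve. *)
Definition contraction : dual_graph I :=
  @DualGraph I {v : G | v \in predC1 x} (fun v => genus (val v))
    (fun v w => dot (val v) (val w) + dot (val v) x * dot (val w) x)
    (fun i => insubd u (foot G i)).

Lemma contraction_sum (R : nmodType) (F : G -> R) :
  \sum_(v : contraction) F (val v) = \sum_(v | v != x) F v.
Proof. by rewrite -(big_sub (op := +%R) (predC1 x) F). Qed.

Lemma contraction_log_resolution : is_log_resolution contraction.
Proof.
split.
- by move=> v w /=; rewrite d_sym mulrC.
- move=> v w vw /=; apply: addr_ge0; first by rewrite d_ge0.
  by rewrite mulr_ge0 // d_ge0 //; [exact: (valP v)|exact: (valP w)].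
- move=> Z Z0.
  (* [Y] is the pull-back of [Z]: its coefficient at E_x is chosen so that Y.E_x = 0. Then Y.E_v =
     Z.E_v at the other curves, so Y and Z have the same self-intersection. *)
  pose Y : {ffun G -> rat} := [ffun v => if insub v is Some v' then Z v'
     else \sum_(w : contraction) Z w * (dot (val w) x)%:~R].
  have Yv (v : contraction) : Y (val v) = Z v by rewrite ffunE valK.
  have Yx : Y x = \sum_(w : contraction) Z w * (dot (val w) x)%:~R.
    by rewrite ffunE insubF // inE /= eqxx.
  have ex : edot Y x = 0.
    rewrite /edot (bigD1 x) //= -(contraction_sum (fun w => Y w * (dot w x)%:~R)).
    rewrite xx mulrN1 Yx addrC; apply/eqP; rewrite subr_eq0; apply/eqP.
    by apply: eq_bigr => w _; congr (_ * _); exact: Yv.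
  have ev (v : contraction) : edot Y (val v) = edot Z v.
    rewrite /edot (bigD1 x) //= -(contraction_sum (fun w => Y w * (dot w (val v))%:~R)).
    rewrite Yx mulr_suml -big_split /=; apply: eq_bigr => w _.
    by rewrite -[Z w]Yv (d_sym x) rmorphD rmorphM /=; ring.
  case: HG => _ _ /(_ Y) nd _; have {nd} := nd _.
  rewrite (bigD1 x) //= ex mulr0 add0r -(contraction_sum (fun w => Y w * edot Y w)).
  have -> : \sum_(v : contraction) Y (val v) * edot Y (val v) =
            \sum_(v : contraction) Z v * edot Z v.
    by apply: eq_bigr => v _; rewrite -ev -[Z v]Yv.
  apply; apply: contraNneq Z0 => Y0; apply/eqP/ffunP=> v.
  by rewrite -Yv Y0 !ffunE.
(* After the contraction all curves that met E_x pass through one point with [u], so a path through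
   E_x can be rerouted through [u]. *)
- have nb (v : contraction) : dot (val v) x != 0 -> connect (@adjacent I contraction) u v.
    move=> vx; have [->|uv] := eqVneq u v; first exact: connect0.
    apply: connect1; rewrite /adjacent uv /= ux mul1r.
    have h1 : 0 <= dot (val u) (val v) by apply: d_ge0.
    have h2 : 0 <= dot (val v) x by apply: d_ge0; exact: (valP v).
    by apply: addz_neq0 h1 h2 _; rewrite vx orbT.
  have sc : connect_sym (@adjacent I contraction).
    apply: sym_connect_sym => v w; rewrite /adjacent eq_sym; congr (_ && _).
    by rewrite /= d_sym mulrC.
  have adj v w : adjacent v w -> connect (@adjacent I contraction) (insubd u v) (insubd u w).
    case/andP=> vw dvw.
    case: (insubP {v : G | v \in predC1 x} v) => [v' _ ev|]; last first.
      rewrite inE /= negbK => /eqP vx; subst v.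
      case: (insubP {v : G | v \in predC1 x} w) => [w' _ ew|].
        rewrite -ew valKd /insubd insubF /= ?inE ?eqxx //.
        by apply: nb; rewrite ew d_sym.
      by rewrite inE /= negbK eq_sym (negbTE vw).
    rewrite -ev valKd.
    case: (insubP {v : G | v \in predC1 x} w) => [w' _ ew|]; last first.
      rewrite inE /= negbK => /eqP wx; subst w; rewrite /insubd insubF /= ?inE ?eqxx //.
      by rewrite sc; apply: nb; rewrite ev.
    rewrite -ew valKd; apply: connect1; rewrite /adjacent.
    have v'w' : v' != w' by apply: contraNneq vw => e; rewrite -ev -ew e.
    have h1 : 0 <= dot (val v') (val w') by apply: d_ge0; rewrite ev ew.
    have h2 : 0 <= dot (val v') x by apply: d_ge0; exact: (valP v').
    have h3 : 0 <= dot (val w') x by apply: d_ge0; exact: (valP w').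
    have h4 : dot (val v') (val w') != 0 by rewrite ev ew.
    by rewrite v'w' /=; apply: addz_neq0 h1 (mulr_ge0 h2 h3) _; rewrite h4.
  move=> v w; rewrite -(valKd u v) -(valKd u w).
  have [_ _ _ /(_ (val v) (val w))/connectP[p]] := HG.
  elim: p (val v) => [|z p IH] y /=; first by move=> _ ->; exact: connect0.
  by case/andP=> /adj h1 h2 e; apply: connect_trans h1 (IH _ h2 e).
Qed.

(** The curve E_v loses its intersections with E_x, and gains [dot (val v) x] times the
    intersections of E_x with the remaining curves. *)
Lemma contraction_valence (v : contraction) :
  valence v = valence (val v) + dot (val v) x * (valence x - 1 - dot (val v) x).
Proof.
have vx := valP v; rewrite inE /= in vx.
have -> : valence v = \sum_(w | (w != x) && (w != val v))
    (dot (val v) w + dot (val v) x * dot w x).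
  by rewrite /valence -(big_sub_cond (op := +%R) (predC1 x) (predC1 (val v))
    (fun w => dot (val v) w + dot (val v) x * dot w x)).
rewrite big_split /= -mulr_sumr.
have -> : valence (val v) = dot (val v) x + \sum_(w | (w != x) && (w != val v)) dot (val v) w.
  rewrite /valence (bigD1 x) 1?eq_sym //=; congr (_ + _).
  by apply: eq_bigl => w; rewrite andbC.
have -> : valence x = dot (val v) x + \sum_(w | (w != x) && (w != val v)) dot w x.
  rewrite /valence (bigD1 (val v)) //= d_sym; congr (_ + _).
  by apply: eq_bigr => w _; rewrite d_sym.
ring.
Qed.

Lemma contraction_iso (m : pred contraction) (t : pred I) :
  (forall v, (m v : nat)%:Z = dot (val v) x) -> (forall i, t i = (foot G i == x)) ->
  graph_iso G (blowup m t).
Proof.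
move=> hm ht; exists (insub : G -> option {v : G | v \in predC1 x}); split.
- exists (fun o => if o is Some v then val v else x).
    by move=> v; case: insubP => [w _ //|]; rewrite inE /= negbK => /eqP.
  by case=> [v|] /=; [rewrite valK|rewrite insubF // inE /= eqxx].
- move=> v; case: insubP => [w _ <- //|]; rewrite inE /= negbK => /eqP->.
  by rewrite gx.
- move=> v w; case: insubP => [v' _ <-|]; last rewrite inE /= negbK => /eqP->;
  case: insubP => [w' _ <-|]; try (rewrite inE /= negbK => /eqP->) => /=.
  + by rewrite /= (hm v') (hm w') addrK.
  + exact: hm.
  + by rewrite d_sym; exact: hm.
  + by rewrite xx.
- move=> i /=; rewrite ht; have [->|fx] := eqVneq (foot G i) x.
    by rewrite insubF // inE /= eqxx.
  by rewrite /insubd (insubT [in predC1 x] fx).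
Qed.

(** Otherwise minimality would make [G] isomorphic to a graph with one curve fewer. *)
Lemma contraction_not_orbifold (m : pred contraction) (t : pred I) :
  (forall H : dual_graph I, is_orbifold_log_resolution H -> dominates G H -> graph_iso G H) ->
  (forall v, (m v : nat)%:Z = dot (val v) x) -> (forall i, t i = (foot G i == x)) ->
  blowup_center m t -> ~ is_orbifold contraction.
Proof.
move=> min hm ht bc orb; have [||h [bh _ _ _]] := min contraction.
- by split=> //; exact: contraction_log_resolution.
- apply: (dominates_blowup bc); apply: dominates_iso; exact: contraction_iso.
have := bij_eq_card bh; rewrite card_sig.
have -> : #|[pred v | v \in predC1 x]| = #|G|.-1 by rewrite -(cardC1 x); apply: eq_card.
have : (0 < #|G|)%N by apply/card_gt0P; exists x.
by case: #|G| => //= n _ /eqP; rewrite eqn_leq ltnn.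
Qed.

End Contraction.

(** * Which (-1)-curves minimality allows on a string *)

Section MinimalStrings.
Set Implicit Arguments.
Unset Strict Implicit.
Unset Printing Implicit Defensive.

Variables (I : finType) (G : dual_graph I).
Implicit Types (x y z f v w : G) (s r : seq G).
Hypothesis HG : is_log_resolution G.

Let d_sym x y : dot x y = dot y x. Proof. by case: HG. Qed.
Let d_ge0 x y : x != y -> 0 <= dot x y. Proof. by case: HG => _ h _ _; apply: h. Qed.

(** A string attached to [v] meets nothing else outside itself, and [v] meets only such strings. By
    connectedness, [v] and these strings exhaust E. *)
Lemma star_shaped_center v : v \notin flatten (end_strings G) ->
  (forall w, w != v -> dot v w != 0 -> w \in flatten (end_strings G)) -> star_shaped G.
Proof.
move=> vS nb; pose ss := [seq s <- end_strings G | dot v (head v s) != 0].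
have ssP s : s \in ss -> end_string_at v s.
  rewrite mem_filter => /andP[dv /end_stringsP[f h]].
  have hs := end_string_head h.
  have vs : v \notin s.
    apply: contra vS => vs; apply/flattenP; exists s => //.
    by apply/end_stringsP; exists f.
  move: dv; have -> : head v s = head f s by case: (s) hs.
  by rewrite d_sym (end_string_dot_outside h hs vs) eqxx; case: (eqVneq v f) => [->|_].
have vss s : s \in ss -> v \notin s by case/ssP => -[/andP[]].
have sub s : s \in ss -> s \in end_strings G by rewrite mem_filter => /andP[].
have all_in y : y \in v :: flatten ss.
  apply: (connected_ind HG (P := [in v :: flatten ss]) (x := v)); first exact: mem_head.
  move=> a b; rewrite inE => /orP[/eqP-> vb dvb|/flattenP[s ss_s as_] ab dab].
    have /flattenP[s sE bs] := nb b (introN eqP (fun e => negP vb (introT eqP (esym e)))) dvb.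
    rewrite inE; apply/orP; right; apply/flattenP; exists s => //; rewrite mem_filter sE andbT.
    have /end_stringsP[f h] := sE; have hs := end_string_head h.
    have vs : v \notin s by apply: contra vS => vs; apply/flattenP; exists s.
    move: (dvb); rewrite d_sym (end_string_dot_outside h bs vs).
    case: (eqVneq b (head f s)) => //= bh _.
    by have -> : head v s = b by rewrite bh; case: (s) hs.
  have h := ssP s ss_s; rewrite inE.
  have [bs|bs] := boolP (b \in s).
    by apply/orP; right; apply/flattenP; exists s.
  by move: dab; rewrite (end_string_dot_outside h as_ bs); case: (b == v); rewrite ?andbF.
(* Distinct strings are disjoint and avoid [v], so every listed edge at [x] comes from the string of
   [x]. *)
have lk s x y : s \in ss -> x \in s ->
    linked (flatten [seq path_edges (v :: s) | s <- ss]) x y = linked (path_edges (v :: s)) x y.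
  move=> s_ss xs; apply/idP/idP => [|h].
    rewrite /linked => /orP[]/flattenP[_ /mapP[s' s'_ss ->] e].
      have /andP[] : (x \in v :: s') && (y \in v :: s').
        by apply: linked_path_mem; rewrite /linked e.
      rewrite inE; have /negbTE-> : x != v by apply: contraNneq (vss _ s_ss) => <-.
      by move=> /(end_strings_disjoint (sub _ s_ss) (sub _ s'_ss) xs)-> _; rewrite e.
    have /andP[] : (y \in v :: s') && (x \in v :: s').
      by apply: linked_path_mem; rewrite /linked e.
    move=> _; rewrite inE; have /negbTE-> : x != v by apply: contraNneq (vss _ s_ss) => <-.
    by move=> /(end_strings_disjoint (sub _ s_ss) (sub _ s'_ss) xs)->; rewrite e orbT.
  by case/orP: h => h; apply/orP; [left|right]; apply/flattenP; exists (path_edges (v :: s)) => //;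
    apply: map_f.
exists v, ss; split.
- apply: uniq_perm; [|exact: enum_uniq|by move=> y; rewrite all_in mem_enum].
  rewrite cons_uniq; apply/andP; split.
    by apply/negP=> /flattenP[s /vss /negbTE->].
  by apply: uniq_flatten_strings => //; rewrite filter_uniq // uniq_end_strings.
- by move=> x /flattenP[s /ssP[_ h _] /h].
- move=> x y xy; have := all_in x; rewrite inE => /orP[/eqP xv|/flattenP[s s_ss xs]].
    have yv : y != v by rewrite -xv eq_sym.
    have := all_in y; rewrite inE (negbTE yv) => /flattenP[s s_ss ys].
    rewrite linked_sym (lk _ _ _ s_ss ys) d_sym.
    by have [[_ _ h] _ _] := ssP _ s_ss; rewrite h.
  rewrite (lk _ _ _ s_ss xs).
  by have [[_ _ h] _ _] := ssP _ s_ss; rewrite h // eq_sym.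
Qed.

Hypothesis Gorb : is_orbifold G.
Hypothesis Gmin : forall H : dual_graph I,
  is_orbifold_log_resolution H -> dominates G H -> graph_iso G H.
Hypothesis Gstar : ~ star_shaped G.

Lemma foot_valence i : valence (foot G i) = 1.
Proof. by case: Gorb => h _; exact/eqP/h. Qed.

Lemma foot_inj i j : foot G i = foot G j -> i = j.
Proof. by case: Gorb => h1 h2 e; apply: (h2 (foot G j)) => //; exact: h1. Qed.

(** The curve [y] has valence 2 and meets two distinct neighbours once each. Its contraction
    therefore preserves all other valences, and it moves no branch since feet have valence 1: the
    result would still be orbifold. *)
Lemma minimal_string_interior f s1 y z r : end_string_at f (s1 ++ y :: z :: r) -> dot y y != -1.
Proof.
move=> h; apply/negP=> /eqP yy; have [ch gs _] := h; have [u _ _] := ch.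
have := chain_uniq_mid u; rewrite inE => /norP[wy]; rewrite inE => /norP[wz wr].
have yz : y != z.
  by move: u => /= /andP[_]; rewrite cat_uniq => /and3P[_ _ /= /andP[]]; rewrite inE => /norP[].
have vy : valence y = 2 by rewrite /valence (chain_valence ch).
have nf i : foot G i != y by apply/eqP=> e; have := foot_valence i; rewrite e vy.
have dy v : v != y -> dot v y = ((v == last f s1) || (v == z) : nat)%:Z.
  by move=> vy'; rewrite d_sym (chain_dot ch vy') /=;
    congr (Posz (nat_of_bool (_ || _))); rewrite eq_sym; apply/eqP/eqP=> [[->]|->].
pose w' : {v : G | v \in predC1 y} := exist _ (last f s1) wy.
have zy : z \in predC1 y by rewrite inE /= eq_sym.
pose z' : {v : G | v \in predC1 y} := exist _ z zy.
have gy : genus y = 0%N by apply: gs; rewrite mem_cat mem_head orbT.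
have wy1 : dot (val w') y = 1 by rewrite dy //= eqxx.
apply: (@contraction_not_orbifold _ G HG y w' gy yy wy1 (pred2 w' z') pred0 Gmin).
- by move=> v; rewrite (dy _ (valP v)).
- by move=> i; rewrite (negbTE (nf i)).
- apply: crossing_point; first by [].
  have -> : @dot I (contraction w') w' z' = dot (last f s1) z + dot (last f s1) y * dot z y by [].
  by have := d_ge0 wz; rewrite (dy _ wy) (dy _ zy) !eqxx orbT /=; lia.
have vH (v : contraction w') : valence v = valence (val v).
  rewrite contraction_valence // vy (dy _ (valP v)).
  by case: (_ || _) => /=; ring.
have fH i : val (foot (contraction w') i) = foot G i by rewrite val_insubd inE /= nf.
split.
  by move=> i; rewrite /end_curve vH fH foot_valence.
by move=> e _ i j <- /(congr1 val); rewrite !fH => /esym /foot_inj.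
Qed.

(** Contracting [y] lowers the valence of its neighbour [w] by 1 and moves a branch at [y], if any,
    to [w]. The result would be orbifold; the excluded case is a single curve met by a branch, where
    [w] need not become an end curve. *)
Lemma minimal_string_end f s1 y : end_string_at f (rcons s1 y) ->
  (s1 != [::]) || [forall i, foot G i != y] -> dot y y != -1.
Proof.
move=> h0; have h : end_string_at f (s1 ++ [:: y]) by rewrite cats1.
move=> hf; apply/negP=> /eqP yy; have [ch gs _] := h; have [u _ _] := ch.
have := chain_uniq_mid u; rewrite mem_seq1 => wy.
have vy : valence y = 1 by rewrite /valence (chain_valence ch).
have dy v : v != y -> dot v y = (v == last f s1 : nat)%:Z.
  by move=> vy'; rewrite d_sym (chain_dot ch vy') /= orbF.
have yS : y \in flatten (end_strings G).
  apply/flattenP; exists (s1 ++ [:: y]); last by rewrite mem_cat mem_head orbT.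
  by apply/end_stringsP; exists f.
pose w := last f s1.
have vw2 : s1 != [::] -> valence w = 2.
  rewrite /w; case/lastP: (s1) ch => // s2 x ch _; rewrite last_rcons.
  by move: ch; rewrite cat_rcons => ch; rewrite /valence (chain_valence ch).
(* If [w] had valence 1, it would be [f], meeting only [y], and E would be star-shaped. Hence no
   branch already meets [w]. *)
have vw1 : valence w != 1.
  case: (eqVneq s1 [::]) => [s10|/vw2->//]; apply/negP=> /eqP v1; apply: Gstar.
  have wf : w = f by rewrite /w s10.
  apply: (@star_shaped_center w).
    apply/flattenP=> -[s /end_stringsP[f' h'] ws].
    by have := end_string_foreign h h'; rewrite -wf ws.
  move=> x xw dx; suff -> : x = y by [].
  apply/eqP/negPn/negP => xy; move: v1; rewrite /valence (bigD1 y) 1?eq_sym //= dy // eqxx.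
  rewrite (bigD1 x) ?xw //=; have := d_ge0 xw; rewrite d_sym.
  have : 0 <= \sum_(i | (i != w) && (i != y) && (i != x)) dot w i.
    by apply: sumr_ge0 => i /andP[/andP[iw _] _]; rewrite d_ge0 // eq_sym.
  by move: dx; rewrite /w; sum_lia.
pose w' : {v : G | v \in predC1 y} := exist _ w wy.
have gy : genus y = 0%N by apply: gs; rewrite mem_cat mem_head orbT.
have wy1 : dot (val w') y = 1 by rewrite dy //= eqxx.
(* A branch at [y] forces [s1] to be nonempty, so [w] lies on the string and becomes an end curve
   that can carry the branch. *)
have fyw i : foot G i = y -> valence w = 2.
  by move=> fi; case/orP: hf => [/vw2 //|/forallP/(_ i)]; rewrite fi eqxx.
have vH (v : contraction w') : valence v = valence (val v) - (val v == w : nat)%:Z.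
  rewrite contraction_valence // vy (dy _ (valP v)).
  by rewrite -/w; case: (_ == _) => /=; ring.
have fH i : val (foot (contraction w') i) = if foot G i == y then w else foot G i.
  by rewrite val_insubd inE /=; case: eqP.
have mH (v : contraction w') : ((v == w') : nat)%:Z = dot (val v) y.
  by rewrite (dy _ (valP v)).
have orb : is_orbifold (contraction w').
  split=> [i|e].
    rewrite /end_curve vH fH; case: (eqVneq (foot G i) y) => [fi|_]; first by rewrite eqxx (fyw i).
    have /negbTE-> : foot G i != w by apply: contraNneq vw1 => <-; rewrite foot_valence.
    by rewrite foot_valence.
  move=> ee i j fi fj; apply: foot_inj; have := fH i; have := fH j; rewrite fi fj.
  case: (eqVneq (foot G j) y) => [fjy|_] ej; case: (eqVneq (foot G i) y) => [fiy|_] ei.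
  - by rewrite fiy fjy.
  - by exfalso; have := foot_valence i; rewrite -ei ej (fyw j).
  - by exfalso; have := foot_valence j; rewrite -ej ei (fyw i).
  - by rewrite -ei.
(* [G] is recovered by blowing up the point of the transferred branch on [w] or, without a branch, a
   general point of [w]. *)
have [i /eqP fi|nf] := pickP (fun i => foot G i == y).
  apply: (@contraction_not_orbifold _ G HG y w' gy yy wy1
    (pred1 (foot (contraction w') i)) (pred1 i) Gmin) orb => //.
  - move=> v; rewrite -mH; congr (Posz (nat_of_bool _)) => /=.
    by apply/eqP/eqP => ->; apply: val_inj; rewrite fH fi eqxx.
  - by move=> j /=; apply/eqP/eqP => [->//|]; rewrite -fi => /foot_inj.
  - exact: foot_point.
apply: (@contraction_not_orbifold _ G HG y w' gy yy wy1 (pred1 w') pred0 Gmin) orb => //.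
exact: general_point.
Qed.

End MinimalStrings.

(** * Weights of strings, and the negative part of the decomposition *)

Section Pair.
Set Implicit Arguments.
Unset Strict Implicit.
Unset Printing Implicit Defensive.

Variables (I : finType) (c : I -> rat) (G : dual_graph (branch c)).
Implicit Types (x y z f v w : G) (s r : seq G).
Hypothesis HG : is_log_resolution G.

Let d_sym x y : dot x y = dot y x. Proof. by case: HG. Qed.
Let d_ge0 x y : x != y -> 0 <= dot x y. Proof. by case: HG => _ h _ _; apply: h. Qed.

Hypothesis Gorb : is_orbifold G.
Hypothesis Gmin : forall H : dual_graph (branch c),
  is_orbifold_log_resolution H -> dominates G H -> graph_iso G H.
Hypothesis Gstar : ~ star_shaped G.
Hypothesis c_bounds : forall i, 0 <= c i <= 1.
Hypothesis c_half : forall i, c i != 0 -> 1 / 2 <= c i.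
Variable D : seq G -> {ffun G -> rat}.
Hypothesis D_cycle : forall s, max_end_string s -> string_cycle s (D s).

(** The curves outside [S] are the core, to which the prefix [core] refers below. *)
Let S : seq G := flatten (end_strings G).

Lemma dotcC_ge0 v : 0 <= dotcC v.
Proof.
apply: sumr_ge0 => i _; rewrite mulr_ge0 // ?ler0n //.
by case/andP: (c_bounds (val i)).
Qed.

Lemma dotcC_valence v : valence v != 1 -> dotcC v = 0.
Proof.
move=> vv; rewrite /dotcC big1 // => i _; rewrite /dotC.
suff /negbTE-> : foot G i != v by rewrite mulr0.
by apply: contraNneq vv => <-; rewrite foot_valence.
Qed.

Lemma dotcC_end s e : last_of s e -> dotcC e = end_coef s.
Proof.
move=> /andP[es /eqP le]; rewrite /end_coef.
have lo v : v \in s -> last_of s v = (v == e).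
  move=> vs; have -> : last_of s v = (last v s == v) by rewrite /last_of vs.
  have -> : last v s = e by rewrite -[RHS]le; case: (s) vs.
  by rewrite eq_sym.
case: pickP => [i /andP[fs /eqP lf]|nf].
  have fe : foot G i = e by apply/eqP; rewrite -lo // /last_of fs lf eqxx.
  rewrite /dotcC (bigD1 i) //= /dotC fe eqxx mulr1 big1 ?addr0 // => j ji.
  suff /negbTE-> : foot G j != e by rewrite mulr0.
  by apply: contraNneq ji => fj; apply/eqP/(foot_inj Gorb); rewrite fj fe.
rewrite /dotcC big1 // => i _; rewrite /dotC.
suff /negbTE-> : foot G i != e by rewrite mulr0.
by apply/eqP=> fi; have := nf i; rewrite fi lo // eqxx.
Qed.

(** The contribution of [s] to N.E_v when [s] is attached to [v]: only the first curve of [s] meets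
    E_v, and it does so once. *)
Definition weight s v : rat := (1 - end_coef s) * D s (head v s).

(** With a branch at the end, [1 - end_coef s <= 1 / 2] and [b = 1 / n <= 1]; equality forces
    [n = 1], hence length 1, as a longer string has all self-intersections at most -2 and
    [n > size s]. Without a branch, always [n > size s >= 1], and equality forces [n = 2] and length
    1. *)
Lemma end_string_weight f s : end_string_at f s ->
  weight s f <= 1 / 2 /\
  (weight s f = 1 / 2 -> exists2 x, s = [:: x] &
     (dot x x = -1 /\ exists i, [/\ foot G i = x, c (val i) = 1 / 2
                        & forall j, foot G j = x -> j = i]) \/
     (dot x x = -2 /\ forall i, foot G i != x)).
Proof.
move=> h; have ms : max_end_string s by apply/max_end_stringP; exists f.
have cyc := D_cycle ms.
have b0 := string_cycle_ge0 HG (head f s) cyc.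
have [n [nb n1 n2]] := string_cycle_head HG h cyc.
rewrite /weight; set b := D s (head f s) in b0 nb *.
have n0 : (0 < n)%N.
  by case: (n) nb => // /eqP; rewrite mul0r eq_sym oner_eq0.
have [s1 [e es]] : exists s1 e, s = rcons s1 e.
  by case/lastP: (s) h => [[[]]//|s1 e]; exists s1, e.
have le : last_of s e by rewrite /last_of es mem_rcons mem_head last_rcons eqxx.
have inner v : v \in s1 -> dot v v <= -2.
  move=> vs; have := dot_self_lt0 HG v.
  suff : dot v v != -1 by lia.
  case: (splitPr vs) es => p1 p2 es; move: h; rewrite es rcons_cat rcons_cons.
  case: p2 {es} => [|z p2]; rewrite /= => h;
    exact: (minimal_string_interior HG Gorb Gmin h).
have selfs : dot e e != -1 -> (size s < n)%N.
  move=> ee; apply: n2 => v; rewrite es mem_rcons inE => /orP[/eqP->|/inner //].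
  by have := dot_self_lt0 HG e; lia.
rewrite es in h; have mend := minimal_string_end HG Gorb Gmin Gstar h.
have size1 : size s = 1%N -> s = [:: e] by rewrite es; case: (s1) => // a [].
rewrite /end_coef; case: pickP => [i /andP[fs /eqP lf]|nf].
  have fe : foot G i = e by move: lf; rewrite es last_rcons.
  have ci := c_half (valP i); have /andP[_ ci1] := c_bounds (val i).
  have b1 : b <= 1.
    have : (1 : rat) <= n%:R by rewrite ler1n.
    nra.
  split; first by nra.
  move=> eq; have bn : b = 1 by nra.
  have cn : c (val i) = 1 / 2 by nra.
  have {nb} nn : n = 1%N by apply/eqP; rewrite -(eqr_nat rat); apply/eqP; rewrite -[RHS]nb bn mulr1.
  have sz : size s = 1%N.
    case: (eqVneq s1 [::]) => [s10|s1n]; first by rewrite es s10.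
    have := selfs; rewrite mend ?s1n // => /(_ isT).
    by rewrite nn es size_rcons.
  exists e; first exact: size1.
  left; split; first by have := n1 sz; rewrite (size1 sz) /= nn.
  by exists i; split=> // j fj; apply: (foot_inj Gorb); rewrite fj fe.
have nfe i : foot G i != e by apply/eqP=> fi; have := nf i; rewrite fi le.
have sn : (size s < n)%N by apply: selfs; apply: mend; apply/orP; right; apply/forallP.
have n2' : (2 <= n)%N by apply: leq_trans sn; rewrite es size_rcons.
have n2r : (2 : rat) <= n%:R by rewrite (ler_nat rat 2).
split; first by nra.
move=> eq; have bn : b = 1 / 2 by lra.
have nn : n = 2%N by apply/eqP; rewrite -(eqr_nat rat); apply/eqP; move: nb; rewrite bn; lra.
have sz : size s = 1%N by move: sn; rewrite nn es size_rcons; case: size.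
exists e; first exact: size1.
by right; split=> //; have := n1 sz; rewrite (size1 sz) /= nn.
Qed.

Lemma end_sumE : end_string_sum D = [ffun v => \sum_(s <- end_strings G) (1 - end_coef s) * D s v].
Proof.
apply/ffunP=> v; rewrite !ffunE.
exact: (sum_end_strings (fun s => (1 - end_coef s) * D s v)).
Qed.

Lemma edot_end_sum v :
  edot (end_string_sum D) v = \sum_(s <- end_strings G) (1 - end_coef s) * edot (D s) v.
Proof.
rewrite end_sumE /edot; under [in RHS]eq_bigr do rewrite mulr_sumr.
rewrite exchange_big /=; apply: eq_bigr => w _; rewrite ffunE mulr_suml.
by apply: eq_bigr => s _; rewrite mulrA.
Qed.

Lemma end_sum_ge0 v : 0 <= end_string_sum D v.
Proof.
rewrite end_sumE ffunE big_seq; apply: sumr_ge0 => s; rewrite mem_end_strings => ms.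
rewrite mulr_ge0 ?(string_cycle_ge0 HG _ (D_cycle ms)) // subr_ge0 /end_coef.
by case: pickP => // i _; case/andP: (c_bounds (val i)).
Qed.

Lemma end_strings_cycle s : s \in end_strings G -> string_cycle s (D s).
Proof. by rewrite mem_end_strings => /D_cycle. Qed.

Lemma end_sum_core v : v \notin S -> end_string_sum D v = 0.
Proof.
move=> vS; rewrite end_sumE ffunE big_seq big1 // => s sE.
have [Z0 _] := end_strings_cycle sE.
rewrite Z0 ?mulr0 //; apply: contra vS => vs; apply/flattenP; by exists s.
Qed.

(** For [v] in the core, [core_valence v] and [string_number v] are the numbers k and m of the
    inequality that bounds P.E_v from below. *)
Definition core_valence v : int := \sum_(w | (w != v) && (w \notin S)) dot v w.
Definition string_number v : int := \sum_(s <- end_strings G) dot (head v s) v.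

Lemma core_attached v s : v \notin S -> s \in end_strings G ->
  exists2 f, end_string_at f s & forall w, w \in s ->
    dot w v = ((w == head v s) && (v == f) : nat)%:Z.
Proof.
move=> vS sE; have /end_stringsP[f h] := sE; exists f => // w ws.
have vs : v \notin s by apply: contra vS => vs; apply/flattenP; exists s.
rewrite (end_string_dot_outside h ws vs).
by have -> : head v s = head f s by case: (s) ws.
Qed.

Lemma core_edot_end_sum v : v \notin S -> edot (end_string_sum D) v =
  \sum_(s <- end_strings G) weight s v * (dot (head v s) v)%:~R.
Proof.
move=> vS; rewrite edot_end_sum; apply: eq_big_seq => s sE.
have [f h dv] := core_attached vS sE; have hs := end_string_head h.
have vs : v \notin s by apply: contra vS => vs; apply/flattenP; exists s.
have [Z0 _] := end_strings_cycle sE.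
rewrite (edot_string_outside h Z0 vs) /weight mulrA.
have hh : head v s = head f s by case: (s) hs.
by rewrite dv hh // eqxx.
Qed.

Lemma core_valenceE v : v \notin S -> valence v = core_valence v + string_number v.
Proof.
move=> vS; rewrite /valence (bigID (mem S)) /= addrC; congr (_ + _).
have -> : \sum_(w | (w != v) && (w \in S)) dot v w = \sum_(w <- S) dot v w.
  rewrite [in RHS]big_uniq; last by apply: uniq_flatten_strings => //; exact: uniq_end_strings.
  by apply: eq_bigl => w; apply: andb_idl => wS; apply: contraNneq vS => <-.
rewrite /S big_flatten; apply: eq_big_seq => s sE.
have [f h dv] := core_attached vS sE; have hs := end_string_head h.
have us : uniq s by case: h => -[/andP[]].
have hv : head v s \in s by case: (s) hs => //= a r _; exact: mem_head.
rewrite (bigD1_seq (head v s)) //= d_sym big_seq_cond big1 ?addr0 //.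
move=> w /andP[ws wh]; by rewrite d_sym dv // (negbTE wh).
Qed.

(** By adjunction (K + E).E_v is the valence minus 2. So both sides are 0 at a non-end curve of the
    string, and [end_coef s - 1] at its end. *)
Lemma edot_string_curve v : v \in S -> edot (end_string_sum D) v =
  dotK G v + dotE G v + dotcC v.
Proof.
move=> /flattenP[s sE vs]; have ms : max_end_string s by rewrite -mem_end_strings.
have /end_stringsP[f h] := sE.
rewrite edot_end_sum (bigD1_seq s) //=; last exact: uniq_end_strings.
rewrite big_seq_cond big1 ?addr0.
  have [_ ->] := D_cycle ms; last by [].
  have [g0 vv] := end_string_valence h vs.
  rewrite /dotK g0 (dotE_valence HG) rmorphD /=.
  have lo : last_of s v = (v == last v s) by rewrite /last_of vs eq_sym.
  have [e|e] := eqVneq v (last v s).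
    have lv : last_of s v by rewrite lo -e eqxx.
    rewrite lv (dotcC_end lv) vv -e eqxx /=; ring.
  rewrite lo (negbTE e) dotcC_valence vv e //=; ring.
move=> s' /andP[s'E s's]; have /end_stringsP[f' h'] := s'E.
have vs' : v \notin s'.
  by apply: contraNN s's => vs'; rewrite (end_strings_disjoint s'E sE vs' vs).
have [Z0 _] := end_strings_cycle s'E.
rewrite (edot_string_outside h' Z0 vs').
have /negbTE-> : v != f' by apply: contraTneq vs => ->; exact: end_string_foreign h' h.
by rewrite !mulr0.
Qed.

Lemma core_valence_gt0 v : v \notin S -> 0 < core_valence v.
Proof.
move=> vS; rewrite lt0r; apply/andP; split; last first.
  by apply: sumr_ge0 => w /andP[wv _]; rewrite d_ge0 // eq_sym.
apply/negP=> /eqP k0; apply: Gstar; apply: (star_shaped_center HG vS) => w wv dvw.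
apply/negPn/negP => wS; move: dvw; apply/negP; rewrite negbK; apply/eqP.
apply: (psumr_eq0P _ k0) => [u /andP[uv _]|]; last by rewrite wv wS.
by rewrite d_ge0 // eq_sym.
Qed.

Lemma string_dot_ge0 v s : v \notin S -> s \in end_strings G -> 0 <= dot (head v s) v <= 1.
Proof.
move=> vS sE; have [f h dv] := core_attached vS sE; have hs := end_string_head h.
rewrite dv; last by case: (s) hs => //= a r _; exact: mem_head.
by rewrite eqxx /=; case: (v == f).
Qed.

Lemma core_string_at v s : v \notin S -> s \in end_strings G ->
  dot (head v s) v != 0 -> end_string_at v s.
Proof.
move=> vS sE; have [f h dv] := core_attached vS sE; have hs := end_string_head h.
rewrite dv; last by case: (s) hs => //= a r _; exact: mem_head.
by case: (eqVneq v f) => [->|]; rewrite ?andbF.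
Qed.

Lemma string_number_ge0 v : v \notin S -> 0 <= string_number v.
Proof.
move=> vS; rewrite /string_number big_seq; apply: sumr_ge0 => s sE.
by case/andP: (string_dot_ge0 vS sE).
Qed.

(** A rational curve of valence 1 lies on a string. A rational curve to which a string is attached
    has valence at least 3 by definition of a maximal end string. *)
Lemma core_rational_valence v : v \notin S -> genus v = 0%N ->
  2 <= valence v /\ (string_number v != 0 -> 3 <= valence v).
Proof.
move=> vS gv; have k0 := core_valence_gt0 vS; have m0 := string_number_ge0 vS.
split.
  have : valence v != 1.
    apply/eqP=> v1; have [s sE /andP[vs _]] := end_curve_in_string HG Gstar gv v1.
    by move: vS; apply/negP; rewrite negbK; apply/flattenP; exists s.
  by move: k0 m0; rewrite core_valenceE //; lia.
move=> mn; have [s sE ds] : exists2 s, s \in end_strings G & dot (head v s) v != 0.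
  apply/hasP; apply: contraNT mn => /hasPn hn.
  by rewrite /string_number big_seq big1 // => s /hn; rewrite negbK => /eqP.
by have [_ _] := core_string_at vS sE ds; rewrite gv.
Qed.

(** This is P.E_v for the candidate positive part P, expressed without choosing an exceptional
    representative of the class. *)
Definition log_excess v : rat :=
  dotK G v + dotE G v + dotcC v - edot (end_string_sum D) v.

(** Each weight is split off from its upper bound 1/2, so that the last sum has nonnegative terms
    and only [2 * genus v - 2 + core_valence v + string_number v / 2] needs discussion. *)
Lemma core_excess v : v \notin S -> log_excess v =
  2 * (genus v)%:R - 2 + (core_valence v)%:~R + dotcC v + (string_number v)%:~R / 2
  + \sum_(s <- end_strings G) (1 / 2 - weight s v) * (dot (head v s) v)%:~R.
Proof.
move=> vS; rewrite /log_excess core_edot_end_sum // (dotE_valence HG) core_valenceE //.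
have -> : \sum_(s <- end_strings G) (1 / 2 - weight s v) * (dot (head v s) v)%:~R
  = (string_number v)%:~R / 2 - \sum_(s <- end_strings G) weight s v * (dot (head v s) v)%:~R.
  rewrite /string_number rmorph_sum mulr_suml -sumrB; apply: eq_bigr => s _ /=.
  by ring.
by rewrite /dotK !rmorphD /=; field.
Qed.

Lemma weight_defect_ge0 v s : v \notin S -> s \in end_strings G ->
  0 <= (1 / 2 - weight s v) * (dot (head v s) v)%:~R.
Proof.
move=> vS sE; have [->|dv] := eqVneq (dot (head v s) v) 0; first by rewrite mulr0.
have /andP[d0 _] := string_dot_ge0 vS sE.
rewrite mulr_ge0 ?ler0z // subr_ge0.
by case: (end_string_weight (core_string_at vS sE dv)).
Qed.

Lemma excess_sum_ge0 v : v \notin S ->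
  0 <= \sum_(s <- end_strings G) (1 / 2 - weight s v) * (dot (head v s) v)%:~R.
Proof. by move=> vS; rewrite big_seq; apply: sumr_ge0 => s; exact: weight_defect_ge0. Qed.

(** With k >= 1, positive genus gives a positive excess. In genus 0, m = 0 forces k >= 2; if m > 0,
    either k >= 2 and the excess is at least m/2, or k = 1 and valence at least 3 gives m >= 2. *)
Lemma core_excess_bound v : v \notin S -> 0 <= log_excess v /\
  (log_excess v = 0 -> genus v = 0%N /\
    ((core_valence v = 2 /\ string_number v = 0) \/
     [/\ core_valence v = 1, string_number v = 2 &
       forall s, s \in end_strings G -> dot (head v s) v != 0 -> weight s v = 1 / 2])).
Proof.
move=> vS; rewrite core_excess //; have w0 := excess_sum_ge0 vS.
set W := \sum_(s <- _) _ in w0 *.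
have WE : W = \sum_(s <- end_strings G) (1 / 2 - weight s v) * (dot (head v s) v)%:~R by [].
have cC := dotcC_ge0 v; have k1 := core_valence_gt0 vS; have m0 := string_number_ge0 vS.
have k1r : (1 : rat) <= (core_valence v)%:~R by rewrite ler1z.
have m0r : (0 : rat) <= (string_number v)%:~R by rewrite ler0z.
have [gv|gv] := posnP (genus v); last first.
  have g1 : (1 : rat) <= (genus v)%:R by rewrite ler1n.
  split; first by lra.
  by move=> e; exfalso; lra.
have [val2 val3] := core_rational_valence vS gv; rewrite core_valenceE // in val2 val3.
rewrite gv mulr0 add0r; have [m_eq0|m_neq0] := eqVneq (string_number v) 0.
  have k2 : 2 <= core_valence v by move: val2; rewrite m_eq0 addr0.
  have k2r : (2 : rat) <= (core_valence v)%:~R by rewrite (ler_int rat 2).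
  rewrite m_eq0 mul0r; split; first by lra.
  move=> e; split=> //; left; split=> //; apply/eqP; rewrite -(eqr_int rat); apply/eqP; lra.
have m1 : 1 <= string_number v by lia.
have m1r : (1 : rat) <= (string_number v)%:~R by rewrite ler1z.
have km := val3 m_neq0.
have [k2|k_lt2] := leP 2 (core_valence v).
  have k2r : (2 : rat) <= (core_valence v)%:~R by rewrite (ler_int rat 2).
  split; first by lra.
  by move=> e; exfalso; lra.
have k_eq1 : core_valence v = 1 by lia.
have m2 : 2 <= string_number v by lia.
have m2r : (2 : rat) <= (string_number v)%:~R by rewrite (ler_int rat 2).
rewrite k_eq1; split; first by rewrite /=; lra.
move=> e; split=> //; right; split=> //.
  by apply/eqP; rewrite -(eqr_int rat); apply/eqP; move: e; rewrite /=; lra.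
have W0 : W = 0 by move: e; rewrite /=; lra.
move=> s sE ds; have /eqP := W0; rewrite WE big_seq psumr_eq0; last first.
  by move=> t; exact: weight_defect_ge0.
move=> /allP/(_ s sE); rewrite sE /=.
by rewrite mulf_eq0 intr_eq0 (negbTE ds) orbF subr_eq0 => /eqP.
Qed.

Lemma excess_ge0 v : 0 <= log_excess v.
Proof.
have [vS|vS] := boolP (v \in S); last by case: (core_excess_bound vS).
by rewrite /log_excess edot_string_curve // subrr.
Qed.

Lemma end_sum_negative_part :
  is_negative_part (fun v => dotK G v + dotE G v + dotcC v) (end_string_sum D).
Proof.
have [L LE] := equiv_to_exists HG (fun v => dotK G v + dotE G v + dotcC v).
have PE v : edot (L - end_string_sum D) v = log_excess v by rewrite edotD edotN LE.
exists L, (L - end_string_sum D); split=> //; split.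
- by rewrite subrK.
- by move=> v; rewrite PE excess_ge0.
- exact: end_sum_ge0.
- move=> v nv; rewrite PE /log_excess; have [vS|vS] := boolP (v \in S).
    by rewrite edot_string_curve // subrr.
  by rewrite end_sum_core ?eqxx in nv.
Qed.


(** * The log canonical case: vanishing of P and the shape of the graph *)

Hypothesis Hlc : log_canonical G.
Hypothesis HC : exists i, c i != 0.

Lemma lc_excess0 v : log_excess v = 0.
Proof.
have [A [AE A1]] := Hlc.
pose P := A + [ffun=> 1] - end_string_sum D.
have PE w : edot P w = log_excess w.
  by rewrite /P !edotD edotN edot_one AE /log_excess; ring.
have P_le0 := nef_le0 HG (fun w => eq_ind_r (fun e => 0 <= e) (excess_ge0 w) (PE w)).
have coreP w : w \notin S -> P w = 0.
  have PwE : P w = A w + 1 - end_string_sum D w.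
    by rewrite /P; move: (end_string_sum D) => N; rewrite !ffunE.
  move=> wS; apply/eqP; rewrite eq_le P_le0 PwE end_sum_core // subr0.
  by have := A1 w; lra.
(* The core is nonempty: the foot of a branch either lies off [S], or lies on a string, whose
   attaching curve is off [S]. *)
clearbody P; have [v0 v0S] : exists v0, v0 \notin S.
  have [i ci] := HC; pose i' : branch c := exist _ i ci.
  have [/flattenP[s sE _]|] := boolP (foot G i' \in S); last by exists (foot G i').
  have /end_stringsP[f h] := sE; exists f; apply/negP=> /flattenP[t /end_stringsP[g h'] ft].
  by have := end_string_foreign h h'; rewrite ft.
rewrite -PE; suff P0 : P = 0 by rewrite P0 /edot big1 // => w _; rewrite ffunE mul0r.
apply/ffunP=> y; rewrite ffunE; apply/eqP; move: y.
apply: (connected_ind HG (P := fun w => P w == 0) (x := v0)); first by rewrite coreP.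
(* If P vanishes at E_a, then P.E_a >= 0 is a sum of nonpositive terms. All of them vanish, so P
   vanishes at every neighbour of E_a. *)
move=> a b /eqP Pa ab dab; have e0 : edot P a = 0.
  apply/eqP; rewrite eq_le PE excess_ge0 andbT -PE /edot (bigD1 a) //= Pa mul0r add0r.
  apply: sumr_le0 => w wa; rewrite mulr_le0_ge0 ?P_le0 // ler0z d_ge0 //.
have := e0; rewrite /edot (bigD1 a) //= Pa mul0r add0r (bigD1 b) /=; last by rewrite eq_sym.
have dba : (0 : rat) < (dot b a)%:~R by rewrite ltr0z d_sym lt0r dab d_ge0.
set T := \sum_(i | _) _; have T0 : T <= 0.
  apply: sumr_le0 => w /andP[wa _]; rewrite mulr_le0_ge0 ?P_le0 // ler0z d_ge0 //.
move=> e; have Pb := P_le0 b; have : P b * (dot b a)%:~R = 0.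
  apply/eqP; rewrite eq_le mulr_le0_ge0 //=; last exact: ltW.
  by move: e T0; lra.
by move/eqP; rewrite mulf_eq0 (gt_eqF dba) orbF.
Qed.

Lemma lc_core v : v \notin S -> genus v = 0%N /\
    ((core_valence v = 2 /\ string_number v = 0) \/
     [/\ core_valence v = 1, string_number v = 2 &
       forall s, s \in end_strings G -> dot (head v s) v != 0 -> weight s v = 1 / 2]).
Proof. by move=> vS; case: (core_excess_bound vS) => _; apply; exact: lc_excess0. Qed.

(** A foot has valence 1, whereas k + m is 2 or 3 on the core. *)
Lemma lc_core_foot v i : v \notin S -> foot G i != v.
Proof.
move=> vS; apply/eqP=> fi; have := foot_valence Gorb i; rewrite fi core_valenceE //.
by case: (lc_core vS) => _ [[-> ->]|[-> -> _]].
Qed.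

Lemma string_number_neq0 v s : v \notin S -> s \in end_strings G ->
  dot (head v s) v != 0 -> string_number v != 0.
Proof.
move=> vS sE ds; rewrite /string_number big_seq psumr_eq0.
  apply/allPn; exists s => //; by rewrite sE.
by move=> t tE; case/andP: (string_dot_ge0 vS tE).
Qed.

Definition lc_leaf x : Prop :=
  genus x = 0%N /\
  ((dot x x = -1 /\ exists i, [/\ foot G i = x, c (val i) = 1 / 2
                      & forall j, foot G j = x -> j = i]) \/
   (dot x x = -2 /\ forall i, foot G i != x)).

Lemma lc_string v s : v \notin S -> s \in end_strings G -> dot (head v s) v != 0 ->
  [/\ core_valence v = 1, string_number v = 2 & exists2 x, s = [:: x] & lc_leaf x].
Proof.
move=> vS sE ds; have := string_number_neq0 vS sE ds.
case: (lc_core vS) => _ [[_ ->]//|[k1 m2 w] _]; split=> //.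
have h := core_string_at vS sE ds; have [_ /(_ (w s sE ds))[x sx lx]] := end_string_weight h.
by exists x => //; split=> //; case: h => _ g0 _; apply: g0; rewrite sx mem_head.
Qed.

Lemma lc_attached_pair v : v \notin S -> core_valence v = 1 ->
  exists a1 a2, [/\ a1 != a2, lc_leaf a1, lc_leaf a2,
    end_string_at v [:: a1] /\ end_string_at v [:: a2]
    & forall s, s \in end_strings G -> dot (head v s) v != 0 -> s \in [:: [:: a1]; [:: a2]]].
Proof.
move=> vS k1; have m2 : string_number v = 2.
  by case: (lc_core vS) => _ [[]|[]] //; rewrite k1.
pose att := [seq s <- end_strings G | dot (head v s) v != 0].
(* Each attached string contributes exactly 1 to [string_number v], which therefore counts them. *)
have sz : size att = 2%N.
  have e2 : Posz 2 = string_number v by rewrite m2.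
  apply/eqP; rewrite -eqz_nat e2 /string_number (bigID (fun s => dot (head v s) v != 0)) /=.
  rewrite [X in _ + X]big1 ?addr0; last by move=> s /negPn/eqP.
  rewrite big_seq_cond (eq_bigr (fun=> 1)); last first.
    move=> s /andP[sE ds]; have := string_dot_ge0 vS sE; move: ds; lia.
  by rewrite -big_seq_cond -big_filter big_const_seq count_predT iter_addr_0 -/att natz.
have attP s : s \in att ->
    [/\ s \in end_strings G, end_string_at v s & exists2 x, s = [:: x] & lc_leaf x].
  rewrite mem_filter => /andP[ds sE]; split=> //; first exact: core_string_at.
  by case: (lc_string vS sE ds).
have uatt : uniq att by rewrite filter_uniq // uniq_end_strings.
have mem_att s : s \in end_strings G -> dot (head v s) v != 0 -> s \in att.
  by move=> sE ds; rewrite mem_filter ds.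
case: att sz attP uatt mem_att => [//|s1 [//|s2 [|//]]] _ attP.
have [_ h1 [a1 e1 l1]] := attP s1 (mem_head _ _).
have [|_ h2 [a2 e2 l2]] := attP s2; first by rewrite !inE eqxx orbT.
rewrite e1 e2 /= inE andbT => a12 mem_att; rewrite e1 in h1; rewrite e2 in h2.
exists a1, a2; split=> //.
by apply: contraNneq a12 => ->.
Qed.

(** Cutting off the form, rather than passing to a subtype, lets the chain lemmas apply to the core
    inside [G]. *)
Definition core_dot x y : int := if (x \in S) || (y \in S) then 0 else dot x y.

Lemma core_dot_sym x y : core_dot x y = core_dot y x.
Proof. by rewrite /core_dot orbC d_sym. Qed.

Lemma core_dot_ge0 x y : x != y -> 0 <= core_dot x y.
Proof. by move=> xy; rewrite /core_dot; case: ifP => // _; exact: d_ge0. Qed.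

Lemma core_dot_valence v : v \notin S -> \sum_(w | w != v) core_dot v w = core_valence v.
Proof.
move=> vS; rewrite /core_valence (bigID (mem S)) /= big1 ?add0r.
  by apply: eq_bigr => w /andP[_ wS]; rewrite /core_dot (negbTE vS) (negbTE wS).
by move=> w /andP[_ wS]; rewrite /core_dot wS orbT.
Qed.

(** Each curve of the chain has a neighbour with nonzero [core_dot], which vanishes on [S]. *)
Lemma core_chain_notin z s x : chain_ending core_dot z s -> x \in z :: s -> x \notin S.
Proof.
have core a b : core_dot a b != 0 -> a \notin S.
  by apply: contraNN => aS; rewrite /core_dot aS.
move=> ch; rewrite inE => /orP[/eqP->|xs].
  case: s ch => [[]//|a r] ch; have [_ e _] := chain_ending_head core_dot_sym ch.
  by apply: (core z a); rewrite e.
case: (splitPr xs) ch => s1 r ch; have [u _ _] := ch.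
have := chain_uniq_mid u; rewrite inE => /norP[lx _].
by apply: (core x (last z s1)); rewrite (chain_dot ch lx) eqxx.
Qed.

(** Some branch exists and its foot is not in the core, so there is a string; its attaching curve
    has k = 1. A walk through the core from there passes curves with k = 2 and stops at another
    curve with k = 1. *)
Lemma lc_core_chain : exists z s,
  [/\ chain_ending core_dot z s, core_valence z = 1, core_valence (last z s) = 1
    & forall x y, x \in z :: s -> x != y ->
        core_dot x y = (linked (path_edges (z :: s)) x y : nat)%:Z].
Proof.
have [i ci] := HC; pose i' : branch c := exist _ i ci.
have : foot G i' \in S by apply: contraT => /(lc_core_foot i'); rewrite eqxx.
case/flattenP=> s sE fs; have /end_stringsP[e h] := sE.
have eS : e \notin S.
  apply/negP=> /flattenP[t /end_stringsP[g h'] et].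
  by have := end_string_foreign h h'; rewrite et.
have ke : core_valence e = 1.
  have es : e \notin s by apply: contra eS => es; apply/flattenP; exists s.
  have hs := end_string_head h.
  have [|//] := lc_string eS sE.
  by rewrite (end_string_dot_outside h hs es) !eqxx.
have := ke; rewrite -core_dot_valence // => /(chain_start core_dot_ge0)[f ch].
have [//|z [s' [c1 c2 _ c4]]] := chain_walk core_dot_sym core_dot_ge0 (stop := pred0) ch.
have zS := core_chain_notin c1 (mem_head _ _).
rewrite /= core_dot_valence // in c4.
have kz : core_valence z = 1 by case: (lc_core zS) => _ [[k]|[]//]; rewrite k in c4.
exists z, s'; split=> //; first by rewrite c2.
by apply: (chain_closed core_dot_sym core_dot_ge0 c1); rewrite core_dot_valence.
Qed.

Lemma lc_graph_of_log_canonical : lc_graph G.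
Proof.
have [z [s [ch kz ke cl]]] := lc_core_chain.
set e := last z s in ke; have [u s0 chs] := ch.
have chS x : x \in z :: s -> x \notin S by exact: core_chain_notin.
have es : e \in s by rewrite /e; case: (s) s0 => //= a r _; exact: mem_last.
have zS := chS z (mem_head _ _); have eS : e \notin S by apply: chS; rewrite inE es orbT.
have ze : z != e by apply: contraTneq es => <-; case/andP: u.
(* An interior curve of the chain has two neighbours in the core. *)
have kchain x : x \in z :: s -> core_valence x = 1 -> x \in [:: z; e].
  rewrite !inE => /orP[->//|xs]; have := chS x; rewrite inE xs orbT => /(_ isT) xS.
  rewrite -(core_dot_valence xS) /e; case: (splitPr xs) ch => s1 r ch'.
  by rewrite (chain_valence ch') last_cat /=; case: r {ch'} => //= _; rewrite eqxx orbT.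
(* By connectedness every curve lies on the chain or on a string attached to it: a closed chain can
   only be left through a string, and a string only through its attaching curve. *)
have attached y : (y \in z :: s) ||
    has (fun t => (y \in t) && has (fun v => dot (head v t) v != 0) (z :: s)) (end_strings G).
  apply: (connected_ind HG (P := fun y => (y \in z :: s) ||
    has (fun t => (y \in t) && has (fun v => dot (head v t) v != 0) (z :: s)) (end_strings G)) (x := z)).
    by rewrite mem_head.
  move=> a b /orP[az|/hasP[t tE /andP[at_ /hasP[v vz dv]]]] ab dab; apply/orP.
    have [/flattenP[t tE bt]|bS] := boolP (b \in S).
      right; apply/hasP; exists t; rewrite // bt; apply/hasP; exists a => //.
      have [f h da] := core_attached (chS a az) tE; move: (dab); rewrite d_sym da //.
      by case: (eqVneq b (head a t)) => //= <- _; rewrite d_sym.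
    left; have := cl _ _ az ab; rewrite /core_dot (negbTE bS) (negbTE (chS a az)) /=.
    by case E: (linked _ _ _) => e0; [case/andP: (linked_path_mem E)|rewrite e0 in dab].
  have [bt|bt] := boolP (b \in t).
    by right; apply/hasP; exists t; rewrite // bt; apply/hasP; exists v.
  left; have h := core_string_at (chS v vz) tE dv.
  by move: dab; rewrite (end_string_dot_outside h at_ bt); case: (eqVneq b v) => [->//|]; rewrite andbF.
have core_in y : y \notin S -> y \in z :: s.
  move=> yS; case/orP: (attached y) => // /hasP[t tE /andP[yt _]].
  by case/negP: yS; apply/flattenP; exists t.
have [a1 [a2 [a12 la1 la2 [ha1 ha2] amem]]] := lc_attached_pair zS kz.
have [b1 [b2 [b12 lb1 lb2 [hb1 hb2] bmem]]] := lc_attached_pair eS ke.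
have leafS v x : end_string_at v [:: x] -> x \in S.
  move=> h; apply/flattenP; exists [:: x]; last exact: mem_head.
  by apply/end_stringsP; exists v.
(* A string of one curve meets only its attaching curve, so leaves attached to different curves
   differ. *)
have ab v w x y : v != w -> end_string_at v [:: x] -> end_string_at w [:: y] -> x != y.
  move=> vw h1 h2; apply: contraNneq vw => xy; subst y.
  have vx : v \notin [:: x] by case: h1 => -[/andP[]].
  have := end_string_dot_outside h1 (mem_head _ _) vx.
  by rewrite (end_string_dot_outside h2 (mem_head _ _) vx) /= !eqxx; case: (v == w).
have string_in x : x \in S -> x \in [:: a1; a2; b1; b2].
  move=> xS; case/orP: (attached x) => [/chS/negP//|/hasP[t tE /andP[xt /hasP[v vz dv]]]].
  have vS := chS v vz; have [kv _ _] := lc_string vS tE dv.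
  move: (kchain v vz kv); rewrite !inE => /orP[]/eqP ev; move: dv; rewrite ev.
    by move=> /(amem t tE); rewrite !inE => /orP[]/eqP et; move: xt; rewrite et inE => ->; rewrite ?orbT.
  by move=> /(bmem t tE); rewrite !inE => /orP[]/eqP et; move: xt; rewrite et inE => ->; rewrite ?orbT.
(* The leaf comes first in each pair, as [linked_pendant] requires. *)
pose es' := [:: (a1, z); (a2, z); (b1, e); (b2, e)].
have ua : uniq (map fst es').
  rewrite /= !inE (negbTE a12) (negbTE b12) /= !andbT !negb_or.
  by rewrite (ab z e a1 b1) // (ab z e a1 b2) // (ab z e a2 b1) // (ab z e a2 b2).
have pend p : p \in es' -> end_string_at p.2 [:: p.1] /\ p.2 \notin S.
  by rewrite !inE => /or4P[]/eqP->.
have edge_leaf x y : x \in S -> x != y ->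
    dot x y = (linked (path_edges (z :: s) ++ es') x y : nat)%:Z.
  move=> xS xy; have := string_in x xS.
  have -> : [:: a1; a2; b1; b2] = map fst es' by [].
  case/mapP=> -[x' f] pe /= ex; subst x'; have [h fS] := pend _ pe.
  have xf : f != x by apply: contraNneq fS => ->.
  rewrite linked_cat; have -> /= : linked (path_edges (z :: s)) x y = false.
    by apply/negP=> /linked_path_mem/andP[/chS/negP].
  rewrite (linked_pendant y ua pe); last first.
    by move=> p /pend[_ pS]; apply: contraNneq pS => ->.
  rewrite (end_string_dot_outside h (mem_head _ _)) /= ?eqxx //.
  by rewrite inE eq_sym.
exists z, s, a1, a2, b1, b2; split=> //.
- apply: uniq_perm; [|exact: enum_uniq|].
    rewrite cat_uniq u ua andbT; apply/hasPn=> x xa; apply/negP=> /chS/negP; apply.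
    by move: xa; rewrite !inE => /or4P[]/eqP->; apply: leafS; eassumption.
  move=> x; rewrite mem_enum mem_cat; have [/string_in->|/core_in->//] := boolP (x \in S).
  by rewrite orbT.
- move=> x y xy; have [xS|xS] := boolP (x \in S); first exact: edge_leaf.
  have [yS|yS] := boolP (y \in S); first by rewrite d_sym linked_sym edge_leaf // eq_sym.
  have := cl _ _ (core_in x xS) xy; rewrite /core_dot (negbTE xS) (negbTE yS) /= => ->.
  rewrite linked_cat; have -> : linked es' x y = false; last by rewrite orbF.
  apply/negP=> /orP[]; move=> /(map_f fst)/= m.
    by case/negP: xS; move: m; rewrite !inE => /or4P[]/eqP->; apply: leafS; eassumption.
  by case/negP: yS; move: m; rewrite !inE => /or4P[]/eqP->; apply: leafS; eassumption.
- move=> x /chS xS; split; first by case: (lc_core xS).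
  by move=> i; exact: lc_core_foot.
- by move=> x; rewrite !inE => /or4P[]/eqP->.
Qed.

End Pair.

Theorem theorem4p6 (I : finType) (c : I -> rat) (G : dual_graph (branch c))
    (D : seq G -> {ffun G -> rat})
    (hc : forall i, 0 <= c i <= 1)
    (hC : exists i, c i != 0)
    (hG : minimal_orbifold_log_resolution G)
    (hstar : ~ star_shaped G)
    (hhalf : forall i, c i != 0 -> 1 / 2 <= c i)
    (hD : forall s, max_end_string s -> string_cycle s (D s)) :
  is_negative_part (fun v => dotK G v + dotE G v + dotcC v) (end_string_sum D)
  /\ (log_canonical G -> lc_graph G).
Proof.
case: hG => -[HG Gorb] Gmin; split.
  exact: (end_sum_negative_part HG Gorb Gmin hstar hc hhalf hD).
by move=> lc; exact: (lc_graph_of_log_canonical HG Gorb Gmin hstar hc hhalf hD lc hC).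
Qed.
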